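(* Let $(b_N)$ be a sequence of positive integers with $b_N\to\infty$ and $b_N=o(N)$. For each $N$ let $\sim$ be an equivalence relation on $\{1,\dots,N\}^2$ with $(p,q)\sim(q,p)$ for all $p,q$, satisfying, as $N\to\infty$, (O1) $\max_p\#\{(q,r,s)\in\{1,\dots,N\}^3:(p,q)\sim(r,s)\}=o(b_N^2)$; (O2) $\max_{p,q,r}\#\{s\in\{1,\dots,N\}:(p,q)\sim(r,s)\}\le B<\infty$ with $B$ independent of $N$; (O3) $\#\{(p,q,r)\in\{1,\dots,N\}^3:(p,q)\sim(q,r),\ r\neq p\}=o(b_N^2)$. Let $(X^{(N)}_{ij})_{1\le i,j\le N}$ be real random variables with $X^{(N)}_{ij}=X^{(N)}_{ji}$, $\mathbb EX^{(N)}_{ij}=0$, $\mathbb E(X^{(N)}_{ij})^2=1$, $\sup_N\max_{i,j}\mathbb E|X^{(N)}_{ij}|^k<\infty$ for all $k$, and such that for each $N$ the families $\{X^{(N)}_{pq}:(p,q)\in C\}$, $C$ ranging over the distinct $\sim$-classes, are mutually independent. Let $$A^{(N)}:=\frac{1}{\sqrt{2b_N}}\Big(\chi_{[0,b_N]}(|i-j|)\,X^{(N)}_{ij}\Big)_{1\le i,j\le N}.$$ Then for all $k\in\mathbb N$, $$\lim_{N\to\infty}\frac1N\mathbb E\big(\operatorname{tr}(A^{(N)})^k\big)=\begin{cases}C_{k/2}&k\text{ even},\\0&k\text{ odd},\end{cases}\qquad C_n=\frac{1}{n+1}\binom{2n}{n}.$$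
   Context: $\chi_{[0,b_N]}(|i-j|)$ equals $1$ if $|i-j|\le b_N$ and $0$ otherwise. *)

(* Defs.v *)
From HB Require Import structures.
From mathcomp Require Import all_boot all_order all_algebra.
From mathcomp Require Import all_classical all_reals all_analysis.
Set Implicit Arguments. Unset Strict Implicit. Unset Printing Implicit Defensive.
Import Order.TTheory GRing.Theory Num.Theory.
Import numFieldNormedType.Exports.
Local Open Scope classical_set_scope.
Local Open Scope ring_scope.

Definition littleo_seq (R : realType) (u v : nat -> R) : Prop :=
  forall eps : R, 0 < eps -> \forall N \near \oo, `|u N| <= eps * `|v N|.

Definition mutually_independent {d} {T : measurableType d} {R : realType}
  (P : probability T R) (K : finType) (I : {set K}) (F : K -> set (set T)) : Prop :=
  forall A : K -> set T, (forall i, i \in I -> F i (A i)) ->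
    P (\bigcap_(i in [set i | i \in I]) A i) = (\prod_(i in I) P (A i))%E.

Definition sigma_gen {d} {T : measurableType d} {R : realType} (K : Type)
  (C : set K) (X : K -> T -> R) : set (set T) :=
  <<s \bigcup_(i in C) preimage_set_system setT (X i) measurable >>.

Definition eq_classes (K : finType) (rel_ : rel K) : {set {set K}} :=
  equivalence_partition rel_ [set: K].

(* Band matrix A^(N) evaluated at the sample point w. *)
Definition band_matrix (R : realType) (N b : nat) (X : 'I_N -> 'I_N -> R) : 'M[R]_N :=
  \matrix_(i < N, j < N)
    ((Num.sqrt (2 * (b%:R : R)))^-1 *
     ((if (`|(i : nat) - (j : nat)| <= b)%N then 1 else 0) * X i j)).

Definition semicircle_moment (R : realType) (k : nat) : R :=
  if odd k then 0 else ('C(k, k./2))%:R / (k./2).+1%:R.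

(* Main.v *)
(* Expanding the trace turns the k-th moment into a sum over closed walks
   x_0, ..., x_(k-1) inside the band, and the walks are sorted by the partition
   that ~ induces on their k edges. A walk with a singleton class contributes 0.
   Otherwise reveal the vertices one after the other along edges: by (O2) a
   vertex reached through an edge of a known class costs at most B choices, and
   through an edge of a new class 2b+1 choices. So walks with fewer than k/2
   classes are negligible. If the classes are pairs and two of them cross,
   l < l' < m < m' with l ~ m and l' ~ m', then (O1) yields the ends of the edges
   l and m in N * o(b^2) ways; filling the gap between them from both sides
   closes the edge l' for free, which leaves N * o(b^2) * O(b^(k/2 - 2)) walks.
   If no classes cross, a stack discipline applies: each second edge of a pair
   finds its partner on top of the stack, and it either undoes the partner or
   gives a triple counted in (O3). The remaining walks run around plane trees and
   contribute 1 each; they correspond to Dyck words with 2b+1 choices at every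
   up step, up to the boundary of the band, and this produces the Catalan
   numbers. *)
Require Import Defs.
From HB Require Import structures.
From mathcomp Require Import all_boot zify.
Set Implicit Arguments. Unset Strict Implicit. Unset Printing Implicit Defensive.

(** * Exploring closed walks *)

Lemma leq_card_fibers (T U : finType) (S : {set T}) (f : T -> U) (c : nat) :
  (forall x, x \in S -> #|[set y in S | f y == f x]| <= c) ->
  #|S| <= c * #|f @: S|.
Proof.
move=> fibS; rewrite -sum1_card (partition_big f (mem (f @: S))) /=; last first.
  by move=> x xS; apply: imset_f.
rewrite mulnC -sum_nat_const; apply: leq_sum => _ /imsetP[x xS ->].
by rewrite sum1dep_card; apply: leq_trans (fibS x xS); rewrite subset_leq_card //;
  apply/subsetP => y; rewrite !inE.
Qed.

(** * Neighbours of a vertex within the band *)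

Section Band.

Variables (n b : nat).

(** The condition |p - q| <= b, written without subtraction since that truncates on natural
    numbers. *)
Definition in_band (p q : 'I_n) := (p <= q + b) && (q <= p + b).

Lemma in_bandC p q : in_band p q = in_band q p.
Proof. by rewrite /in_band andbC. Qed.

(** The offset q + b - p lies between 0 and 2b and determines q. *)
Lemma card_in_band p : #|[set q | in_band p q]| <= (2 * b).+1.
Proof.
have inj : {in [set q | in_band p q] &, injective (fun q : 'I_n => (q + b - p))}.
  move=> q1 q2; rewrite !inE /in_band => h1 h2 h; apply: val_inj => /=; lia.
rewrite -(card_in_imset (f := fun q : 'I_n => (inord (q + b - p) : 'I_(2 * b).+1))).
  by rewrite -[X in _ <= X]card_ord max_card.
move=> q1 q2 h1 h2 /(congr1 val); rewrite /= !inordK; first exact: inj.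
  by move: h2; rewrite inE /in_band; lia.
by move: h1; rewrite inE /in_band; lia.
Qed.

End Band.

(** * Partial walks and the cost of revealing a vertex *)

Section Exploration.

Variables (k n : nat).

(** [ordS] is the cyclic successor, so the last edge returns to the first vertex and every tuple is
    a closed walk. *)
Definition edge (x : k.-tuple 'I_n) (l : 'I_k) := (tnth x l, tnth x (ordS l)).

(** With [None] off [A], partial walks on all index sets share one type. Exploration follows
    [#|restr A @: S|], the number of ways to choose the vertices in [A], while [A] grows. *)
Definition restr (A : {set 'I_k}) (x : k.-tuple 'I_n) : {ffun 'I_k -> option 'I_n} :=
  [ffun l => if l \in A then Some (tnth x l) else None].

Lemma restrP (A : {set 'I_k}) (x y : k.-tuple 'I_n) :
  restr A x = restr A y -> forall l, l \in A -> tnth x l = tnth y l.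
Proof. by move=> /ffunP xy l lA; move: (xy l); rewrite !ffunE lA => -[]. Qed.

Lemma restrT_inj : injective (restr setT).
Proof.
move=> x y /restrP xy; apply: eq_from_tnth => l; exact: xy.
Qed.

(** Forgetting the new vertex maps the larger restrictions onto the smaller ones, and an element of
    a fibre is recovered from its value at [v]. *)
Lemma card_restr_step (S : {set k.-tuple 'I_n}) (A : {set 'I_k}) (v : 'I_k) (c : nat) :
  (forall x, x \in S ->
     #|[set tnth y v | y in S & restr A y == restr A x]| <= c) ->
  #|restr (v |: A) @: S| <= c * #|restr A @: S|.
Proof.
move=> Hc.
pose msk (h : {ffun 'I_k -> option 'I_n}) : {ffun 'I_k -> option 'I_n} :=
  [ffun l => if l \in A then h l else None].
have mskE x : msk (restr (v |: A) x) = restr A x.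
  by apply/ffunP => l; rewrite !ffunE !inE; case: (l \in A) => //; rewrite orbT.
have -> : restr A @: S = msk @: (restr (v |: A) @: S).
  by rewrite -imset_comp; apply: eq_imset => x /=; rewrite mskE.
apply: leq_card_fibers => _ /imsetP[x xS ->].
apply: leq_trans (Hc x xS); rewrite mskE.
pose ext (w : 'I_n) : {ffun 'I_k -> option 'I_n} :=
  [ffun l => if l == v then Some w else restr A x l].
apply: leq_trans (leq_imset_card ext _).
apply/subset_leq_card/subsetP => h; rewrite inE => /andP[/imsetP[y yS ->]].
rewrite mskE => yx; apply/imsetP; exists (tnth y v).
  by apply/imsetP; exists y; rewrite // inE yS.
apply/ffunP => l; move/eqP/ffunP: yx => /(_ l); rewrite !ffunE !inE.
by case: (l =P v) => [-> //|_] /=.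
Qed.

Variables (b B : nat) (e : rel ('I_n * 'I_n)).
Hypothesis B_gt0 : 0 < B.
Hypothesis e_trans : transitive e.
Hypothesis e_swap : forall p q, e (p, q) (q, p).
Hypothesis eB : forall p q r : 'I_n, #|[set s : 'I_n | e (p, q) (r, s)]| <= B.

Definition banded (x : k.-tuple 'I_n) := [forall l, in_band b (tnth x l) (tnth x (ordS l))].

(** The classes of [K] not met so far, where an edge is met once both its ends are known. Each of
    them may still cost one factor 2b+1. *)
Definition opened (K : {set {set 'I_k}}) (A : {set 'I_k}) : {set {set 'I_k}} :=
  [set c in K | ~~ [exists l in c, (l \in A) && (ordS l \in A)]].

Variables (pi : rel 'I_k) (S : {set k.-tuple 'I_n}).
Hypothesis S_banded : forall x, x \in S -> banded x.
Hypothesis S_pi : forall x, x \in S -> forall l m, e (edge x l) (edge x m) = pi l m.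

(* The edge l has exactly one end in A. Its other end v costs B choices if the
   class of l already occurs inside A; otherwise it costs 2b+1 choices, but then
   a class of K stops being open. *)
Lemma explore_step (K : {set {set 'I_k}}) (A : {set 'I_k}) (l v : 'I_k) :
  (forall c, c \in K -> forall i j, i \in c -> j \in c -> pi i j) ->
  (exists2 c, c \in K & l \in c) ->
  (l \in A) && (v == ordS l) || (ordS l \in A) && (v == l) ->
  #|restr (v |: A) @: S| * (2 * b).+1 ^ #|opened K (v |: A)|
    <= #|restr A @: S| * B * (2 * b).+1 ^ #|opened K A|.
Proof.
move=> Kpi [c cK lc] lv.
have sub : opened K (v |: A) \subset opened K A.
  apply/subsetP => d; rewrite !inE => /andP[-> /=]; apply: contra.
  move=> /existsP[j]; case/and3P=> jd jA sjA; apply/existsP; exists j.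
  by rewrite jd !inE jA sjA !orbT.
have [|cA] := boolP (c \in opened K A).
  move=> cA.
  have cA' : c \notin opened K (v |: A).
    rewrite !inE cK /= negbK; apply/existsP; exists l; rewrite lc !inE /=.
    by case/orP: lv => /andP[-> /eqP ->]; rewrite eqxx !orbT.
  have lt : #|opened K (v |: A)| < #|opened K A|.
    rewrite proper_card // properE sub /=; apply/subsetPn; by exists c.
  have st : #|restr (v |: A) @: S| <= (2 * b).+1 * #|restr A @: S|.
    apply: card_restr_step => x xS.
    pose u := if v == ordS l then l else ordS l.
    apply: leq_trans (card_in_band b (tnth x u)).
    apply/subset_leq_card/subsetP => z /imsetP[y]; rewrite !inE => /andP[yS /eqP yx] ->.
    have /forallP/(_ l) := S_banded yS.
    have/orP[/andP[lA /eqP vE]|/andP[lA /eqP vE]] := lv.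
      by rewrite /u vE eqxx (restrP yx lA).
    (* The equality [l = ordS l] occurs only for [k = 1], and then the vertex [v] lies in [A]
       already. *)
    rewrite /u vE; case: ifP => [/eqP lE|_]; last by rewrite (restrP yx lA) in_bandC.
    by have lA2 : l \in A; [rewrite lE|rewrite -lE (restrP yx lA2)].
  apply: leq_trans (leq_mul st (leqnn _)) _.
  rewrite -mulnA mulnCA -expnS -mulnA leq_mul2l; apply/orP; right.
  by rewrite -[X in X <= _]mul1n leq_mul // leq_pexp2l.
move: cA; rewrite inE cK /= negbK => /existsP[j]; case/and3P=> jc jA sjA.
have st : #|restr (v |: A) @: S| <= B * #|restr A @: S|.
  apply: card_restr_step => x xS.
  pose u := if v == ordS l then l else ordS l.
  (* The edge [j] of the same class is known, so (O2) applies, with [u] the known end of the edge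
     [l]. *)
  apply: leq_trans (eB (tnth x j) (tnth x (ordS j)) (tnth x u)).
  apply/subset_leq_card/subsetP => z /imsetP[y]; rewrite !inE => /andP[yS /eqP yx] ->.
  have := S_pi yS j l; rewrite (Kpi c cK) // /edge.
  rewrite (restrP yx jA) (restrP yx sjA).
  have/orP[/andP[lA /eqP vE]|/andP[lA /eqP vE]] := lv.
    by rewrite /u vE eqxx (restrP yx lA).
  rewrite /u vE; case: ifP => [/eqP lE|_].
    by have lA2 : l \in A; [rewrite lE|rewrite -lE (restrP yx lA2)].
  (* (O2) bounds the second vertex of a pair; if the unknown end comes first, [e_swap] turns the
     edge round. *)
  rewrite (restrP yx lA) => E; exact: e_trans E (e_swap _ _).
apply: leq_mul; first by rewrite mulnC.
by rewrite leq_pexp2l // subset_leq_card.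
Qed.

(** Iterates [explore_step] from [A] up to [D], adding at most k vertices. The exploration walks
    only along edges of [G], whose classes lie in [K]; so a class can be kept out of the account by
    avoiding its edges, as the crossing case needs. *)
Lemma explore (K : {set {set 'I_k}}) (G A D : {set 'I_k}) :
  (forall c, c \in K -> forall i j, i \in c -> j \in c -> pi i j) ->
  (forall l, l \in G -> exists2 c, c \in K & l \in c) ->
  A \subset D ->
  (forall A' : {set 'I_k}, A \subset A' -> A' \proper D ->
     exists2 l, l \in G & [&& l \in D, ordS l \in D & (l \in A') != (ordS l \in A')]) ->
  #|restr D @: S| * (2 * b).+1 ^ #|opened K D|
    <= #|restr A @: S| * B ^ k * (2 * b).+1 ^ #|opened K A|.
Proof.
move=> Kpi GK AD grow.
suff main : forall m (A' : {set 'I_k}), A \subset A' -> A' \subset D -> #|D :\: A'| = m ->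
  #|restr D @: S| * (2 * b).+1 ^ #|opened K D|
    <= #|restr A' @: S| * B ^ m * (2 * b).+1 ^ #|opened K A'|.
  apply: leq_trans (main _ A (subxx _) AD erefl) _.
  rewrite leq_mul2r leq_mul2l leq_pexp2l ?orbT //.
  by rewrite -[X in _ <= X]card_ord max_card.
elim=> [|m IH] A' AA' A'D cm.
  move/eqP: cm; rewrite cards_eq0 setD_eq0 => DA'.
  by have -> : A' = D; [apply/eqP; rewrite eqEsubset A'D|rewrite muln1].
have A'pD : A' \proper D.
  rewrite properE A'D /=; apply/negP => DA'; move: cm.
  by move: DA'; rewrite -setD_eq0 => /eqP ->; rewrite cards0.
have [l lG /and3P[lD slD lA']] := grow A' AA' A'pD.
pose v := if l \in A' then ordS l else l.
have vD : v \in D by rewrite /v; case: ifP.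
have vA' : v \notin A' by move: lA'; rewrite /v; case: (boolP (l \in A')); case: (boolP (ordS l \in A')).
apply: leq_trans (IH (v |: A') _ _ _) _.
- exact: subset_trans AA' (subsetUr _ _).
- by rewrite subUset sub1set vD.
- move: cm; rewrite (cardsD1 v) !inE vD vA' add1n => -[<-].
  by congr #|pred_of_set _|; apply/setP => j; rewrite !inE negb_or andbA.
rewrite mulnAC expnS mulnA [X in _ <= X]mulnAC leq_mul2r; apply/orP; right.
apply: (explore_step Kpi (GK l lG)).
by move: lA'; rewrite /v; case: (boolP (l \in A')); case: (boolP (ordS l \in A'));
  rewrite /= ?eqxx.
Qed.

End Exploration.

(** * Index sets on a cycle and on an interval *)

(** If membership never changed along [ordS], one member would carry it round the whole cycle. *)
Lemma ordS_boundary (k : nat) (A : {set 'I_k}) :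
  A != set0 -> A \proper [set: 'I_k] -> exists l, (l \in A) != (ordS l \in A).
Proof.
move=> /set0Pn[i iA] /properP[_ [j _ jA]].
apply/existsP; rewrite -[[exists _, _]]negbK; apply/negP => /existsPn H.
have {}H l : (ordS l \in A) = (l \in A) by apply/esym/eqP; have := H l; rewrite negbK.
have Hi d : forall l : 'I_k, (l : nat) = (i + d) %% k -> l \in A.
  elim: d => [|d IH] l ll.
    by have -> : l = i by apply: val_inj; rewrite /= ll addn0 modn_small.
  have k0 : 0 < k by rewrite (leq_ltn_trans _ (ltn_ord i)).
  have -> : l = ordS (Ordinal (ltn_pmod (i + d) k0)).
    by apply: val_inj => /=; rewrite ll addnS -addn1 -modnDml addn1.
  by rewrite H; apply: IH.
(* From i, [k - i] successors lead to 0 and j further ones to j. *)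
move/negP: jA; apply; apply: (Hi (k - i + j)).
by rewrite addnA subnKC ?(ltnW (ltn_ord i)) // modnDl modn_small.
Qed.

Lemma fill_interval (k : nat) (A : {set 'I_k}) (l l' m : 'I_k) : l < l' -> l' < m ->
  (forall j j' : 'I_k, l < j -> j < m -> j != l' -> j' = j.+1 :> nat ->
     (j \in A) = (j' \in A)) ->
  (forall j : 'I_k, j = l.+1 :> nat -> j \in A) -> m \in A ->
  forall j : 'I_k, l < j <= m -> j \in A.
Proof.
move=> ll' l'm step lA mA.
have up d : forall j : 'I_k, j = l.+1 + d :> nat -> j <= l' -> j \in A.
  elim: d => [|d IH] j jE jl'; first by apply: lA; rewrite jE addn0.
  have jk : l.+1 + d < k by move: (ltn_ord j); lia.
  rewrite -(step (Ordinal jk)) /=; first by apply: IH => //=; lia.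
  + lia.
  + lia.
  + by rewrite -val_eqE /=; lia.
  + lia.
have down d : forall j : 'I_k, j + d = m :> nat -> l' < j -> j \in A.
  elim: d => [|d IH] j jE jl'.
    by have -> // : j = m; apply: val_inj; rewrite /= -jE addn0.
  have jk : j.+1 < k by move: (ltn_ord m); lia.
  rewrite (step j (Ordinal jk)) //=; first by apply: IH => //=; lia.
  + lia.
  + lia.
  + by rewrite -val_eqE /=; lia.
move=> j /andP[lj jm]; have [jl'|jl'] := leqP j l'.
  by apply: (up (j - l.+1)) => //; rewrite subnKC.
by apply: (down (m - j)) => //; rewrite subnKC.
Qed.

Section EquivalenceRel.

Variables (T : Type) (e : rel T).
Hypothesis e_equiv : equivalence_rel e.

Lemma equivalence_refl : reflexive e.
Proof. by move=> p; have [] := e_equiv p p p. Qed.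

Lemma equivalence_sym : symmetric e.
Proof.
have sym p q : e p q -> e q p.
  by move=> pq; have [_ /(_ pq)] := e_equiv p q p; rewrite equivalence_refl.
by move=> p q; apply/idP/idP; apply: sym.
Qed.

Lemma equivalence_trans : transitive e.
Proof. by move=> q p r pq qr; have [_ /(_ pq) ->] := e_equiv p q r. Qed.

End EquivalenceRel.

(** * Counting walks by the partition of their edges *)

Section WalkCounts.

Variables (k n : nat) (b B : nat) (e : rel ('I_n * 'I_n)).
Hypothesis B_gt0 : 0 < B.
Hypothesis e_equiv : equivalence_rel e.
Hypothesis e_swap : forall p q, e (p, q) (q, p).
Hypothesis eB : forall p q r : 'I_n, #|[set s : 'I_n | e (p, q) (r, s)]| <= B.

Notation walk := (k.-tuple 'I_n).
Notation a := (2 * b).+1.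

Definition linked (x : walk) : rel 'I_k := fun l m => e (edge x l) (edge x m).

Definition blocks (x : walk) : {set {set 'I_k}} := equivalence_partition (linked x) [set: 'I_k].

Definition block (x : walk) (l : 'I_k) : {set 'I_k} := [set m | linked x l m].

Definition pairing (x : walk) := [forall l, #|block x l| == 2].

Definition crossing (x : walk) := [exists l : 'I_k, exists l' : 'I_k,
  exists m : 'I_k, exists m' : 'I_k, [&& l < l', l' < m, m < m', linked x l m & linked x l' m']].

(** The second edge of a pair starts where the first ended but does not undo it: (p, q) and (q, r)
    with r != p, which is a triple of (O3). *)
Definition skewed (x : walk) := [exists l : 'I_k, exists m : 'I_k,
  [&& l < m, linked x l m, tnth x (ordS l) == tnth x m
    & tnth x l != tnth x (ordS m)]].

(** Besides the partition of the edges it records which vertices coincide, so that the indices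
    witnessing [skewed] serve for a whole fibre. The number of patterns depends on k only. *)
Let pattern (x : walk) := ([set p : 'I_k * 'I_k | linked x p.1 p.2],
                           [set p : 'I_k * 'I_k | tnth x p.1 == tnth x p.2]).

Definition pattern_count := #|{: {set 'I_k * 'I_k} * {set 'I_k * 'I_k}}|.

Let e_refl := equivalence_refl e_equiv.
Let e_sym := equivalence_sym e_equiv.
Let e_trans := equivalence_trans e_equiv.

Lemma linked_equiv x : {in [set: 'I_k] & &, equivalence_rel (linked x)}.
Proof. by move=> i j l _ _ _; apply: e_equiv. Qed.

Lemma block_in_blocks x l : block x l \in blocks x.
Proof. by apply/imsetP; exists l; rewrite ?inE //; apply/setP => m; rewrite !inE. Qed.

Lemma blocksP x c : reflect (exists l, c = block x l) (c \in blocks x).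
Proof.
apply: (iffP idP) => [/imsetP[l _ ->]|[l ->]]; last exact: block_in_blocks.
by exists l; apply/setP => m; rewrite !inE.
Qed.

Lemma mem_block x l : l \in block x l.
Proof. by rewrite inE /linked e_refl. Qed.

Lemma eq_block x l m : linked x l m -> block x l = block x m.
Proof.
move=> lm; apply/setP => j; rewrite !inE /linked.
by have [_ /(_ lm)] := e_equiv (edge x l) (edge x m) (edge x j).
Qed.

Lemma sum_card_blocks x : \sum_(c in blocks x) #|c| = k.
Proof.
by rewrite -(card_partition (equivalence_partitionP (@linked_equiv x))) cardsT card_ord.
Qed.

Lemma pairing_blocks x : pairing x -> 2 * #|blocks x| = k.
Proof.
move=> /forallP px; rewrite -[RHS](sum_card_blocks x) mulnC -sum_nat_const.
by apply: eq_bigr => c /blocksP[l ->]; rewrite (eqP (px l)).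
Qed.

(** The block sizes add up to k and are at least 2; a single larger block makes the inequality
    strict. *)
Lemma few_blocks_or_pairing x : (forall l, 1 < #|block x l|) ->
  (2 * #|blocks x| < k) || pairing x.
Proof.
move=> sz2; have [/forallP px|] := boolP (pairing x); first by rewrite orbT.
case/forallPn=> l l2; rewrite orbF mulnC -[X in _ < X](sum_card_blocks x).
rewrite -sum_nat_const (bigD1 (block x l)) ?block_in_blocks //=.
rewrite [X in _ < X](bigD1 (block x l)) ?block_in_blocks //= -addSn leq_add //.
  by rewrite ltn_neqAle eq_sym l2 sz2.
by apply: leq_sum => c /andP[/blocksP[j ->] _]; apply: sz2.
Qed.

Lemma linked_fiber x y : pattern x = pattern y -> linked x =2 linked y.
Proof. by case=> /setP xy _ l m; have := xy (l, m); rewrite !inE. Qed.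

Lemma tnth_fiber x y : pattern x = pattern y ->
  forall l m, (tnth x l == tnth x m) = (tnth y l == tnth y m).
Proof. by case=> _ /setP xy l m; have := xy (l, m); rewrite !inE. Qed.

Lemma card_by_pattern (S : {set walk}) c :
  (forall x, x \in S -> #|[set y in S | pattern y == pattern x]| <= c) ->
  #|S| <= pattern_count * c.
Proof.
move=> H; apply: leq_trans (leq_card_fibers H) _.
by rewrite mulnC leq_mul // max_card.
Qed.

(** Choosing a preimage under [phi] recovers the restriction, so [phi] may keep any data that
    determine the walk on [A]. *)
Lemma card_restr_le (S : {set walk}) (A : {set 'I_k}) (U : finType) (V : {set U})
    (phi : walk -> U) :
  (forall x, x \in S -> phi x \in V) ->
  (forall x y, x \in S -> y \in S -> phi x = phi y ->
     forall l, l \in A -> tnth x l = tnth y l) ->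
  #|restr A @: S| <= #|V|.
Proof.
move=> SV phi_inj; apply: leq_trans (_ : #|phi @: S| <= _); last first.
  by apply/subset_leq_card/subsetP => _ /imsetP[x xS ->]; exact: SV.
have [->|/set0Pn[x0 x0S]] := eqVneq S set0; first by rewrite !imset0 !cards0.
pose g u := if [pick x in S | phi x == u] is Some x then restr A x else restr A x0.
apply: leq_trans (leq_imset_card g _).
apply/subset_leq_card/subsetP => _ /imsetP[x xS ->].
apply/imsetP; exists (phi x); first exact: imset_f.
rewrite /g; case: pickP => [y /andP[yS /eqP yx]|/(_ x)]; last by rewrite xS eqxx.
apply/ffunP => l; rewrite !ffunE; case: ifP => // lA.
by rewrite (phi_inj _ _ xS yS).
Qed.

Section OnePattern.

Variables (x0 : walk) (S : {set walk}).
Hypothesis S_banded : forall x, x \in S -> banded b x.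
Hypothesis S_pattern : forall x, x \in S -> linked x =2 linked x0.

Let K := blocks x0.

Lemma blocks_linked c : c \in K -> forall i j, i \in c -> j \in c -> linked x0 i j.
Proof.
move=> /blocksP[l ->] i j; rewrite !inE /linked => li lj.
by apply: e_trans lj; rewrite e_sym.
Qed.

(** A nonempty set short of the whole cycle has a boundary edge, so the exploration never gets
    stuck. The power of [a] left at the end is at least 1 and is dropped. *)
Lemma explore_closed (A : {set 'I_k}) : A != set0 ->
  #|S| <= #|restr A @: S| * B ^ k * a ^ #|opened K A|.
Proof.
move=> A0.
have := @explore k n b B e B_gt0 e_trans e_swap eB (linked x0) S S_banded S_pattern
  K setT A setT blocks_linked.
rewrite (card_imset _ (@restrT_inj k n)) => H.
apply: leq_trans (_ : #|S| * a ^ #|opened K setT| <= _).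
  by rewrite -[X in X <= _]muln1 leq_mul2l expn_gt0 orbT.
apply: H => //.
- by move=> l _; exists (block x0 l); rewrite ?mem_block ?block_in_blocks.
move=> A' AA' A'T; have [|l lA'] := ordS_boundary _ A'T.
  by apply: contraNneq A0 => A'0; rewrite -subset0 -A'0.
by exists l; rewrite ?inE.
Qed.

(** Exploration starts from the vertex at index 0, which has n choices. *)
Lemma card_walks_le : 0 < k -> #|S| <= n * B ^ k * a ^ #|K|.
Proof.
move=> k0; pose l0 := Ordinal k0.
apply: leq_trans (explore_closed (A := [set l0]) _) _.
  by apply/set0Pn; exists l0; rewrite inE.
apply: leq_mul; last first.
  by rewrite leq_pexp2l // subset_leq_card //; apply/subsetP => c; rewrite inE => /andP[].
rewrite leq_mul2r; apply/orP; right.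
rewrite -[X in _ <= X]card_ord -cardsT.
apply: (card_restr_le (phi := fun x => tnth x l0)) => [x _|x y _ _ xy l].
  by rewrite inE.
by rewrite inE => /eqP ->.
Qed.

(** Exploration starts from the edges [l] and [m], whose three vertices form a triple of (O3). Their
    class is then no longer open, which saves one factor [a]. *)
Lemma card_skewed_le (l m : 'I_k) :
  (forall x, x \in S ->
     [/\ linked x l m, tnth x (ordS l) = tnth x m & tnth x l != tnth x (ordS m)]) ->
  linked x0 l m ->
  #|S| <= #|[set t : 'I_n * 'I_n * 'I_n | e (t.1.1, t.1.2) (t.1.2, t.2) && (t.2 != t.1.1)]|
          * B ^ k * a ^ (#|K|.-1).
Proof.
move=> Slm lm; pose A := [set l; ordS l; m; ordS m].
apply: leq_trans (explore_closed (A := A) _) _.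
  by apply/set0Pn; exists l; rewrite !inE eqxx.
apply: leq_mul; last first.
  rewrite leq_pexp2l // (cardsD1 (block x0 l) K) block_in_blocks add1n /=.
  apply/subset_leq_card/subsetP => c; rewrite !inE => /andP[-> /=].
  rewrite andbT; apply: contra => /eqP ->; apply/existsP; exists l.
  by rewrite mem_block !inE !eqxx !orbT.
rewrite leq_mul2r; apply/orP; right.
apply: (card_restr_le (phi := fun x => (tnth x l, tnth x (ordS l), tnth x (ordS m)))).
  move=> x xS; have [lmx sl lsm] := Slm x xS; rewrite inE /= eq_sym lsm andbT.
  by move: lmx; rewrite /linked /edge -sl.
move=> x y xS yS [xy1 xy2 xy3] j.
have [_ slx _] := Slm x xS; have [_ sly _] := Slm y yS.
rewrite !inE => /orP[/orP[/orP[]|]|] /eqP -> //.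
by rewrite -slx -sly.
Qed.

(** Two phases, each at the price [B ^ k]. From the ends of the edges [l] and [m] the gap between
    them is filled from both sides without walking along [l']; then the rest of the cycle is
    explored. Neither the class of [l] nor that of [l'] costs a factor [a]. *)
Lemma card_crossing_le (l l' m m' : 'I_k) M :
  (forall p : 'I_n, #|[set t : 'I_n * 'I_n * 'I_n | e (p, t.1.1) (t.1.2, t.2)]| <= M) ->
  pairing x0 -> l < l' -> l' < m -> m < m' -> linked x0 l m -> linked x0 l' m' ->
  #|S| <= n * M * B ^ (2 * k) * a ^ (#|K| - 2).
Proof.
move=> HM px ll' l'm mm' lm l'm'.
pose A := [set l; ordS l; m; ordS m].
pose D := [set j : 'I_k | l <= j <= m] :|: [set ordS m].
(* The class of [l'] must not be charged in the first phase, so it is left out. *)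
pose K1 := K :\ block x0 l'.
have ordSE (j : 'I_k) : j < m -> ordS j = j.+1 :> nat.
  by move=> jm /=; rewrite modn_small // (leq_ltn_trans jm).
have card3 (i j p q : 'I_k) : j \in block x0 i -> p \in block x0 i -> q \in block x0 i ->
    j != p -> (q == j) || (q == p).
  move=> ji pi_ qi jp; have := eqP (forallP px i) => c2.
  have : [set j; p] == block x0 i.
    rewrite eqEcard c2 cards2 jp andbT; apply/subsetP => z.
    by rewrite !inE => /orP[] /eqP ->; move: ji pi_; rewrite !inE.
  by move/eqP => E; move: qi; rewrite -E !inE.
have in_l' j : j \in block x0 l' -> (j == l') || (j == m').
  move=> jl'; apply: (card3 l') => //; rewrite ?mem_block ?inE //.
  by apply/eqP => E; move: l'm mm'; rewrite E; lia.
have ll'_block : block x0 l != block x0 l'.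
  apply/eqP => E; have := mem_block x0 l; rewrite E => /in_l' /orP[] /eqP H; subst l; lia.
have AD : A \subset D.
  apply/subsetP => j; rewrite !inE => /orP[/orP[/orP[]|]|] /eqP ->.
  - by rewrite leqnn (ltnW (ltn_trans ll' l'm)).
  - by apply/orP; left; rewrite ordSE ?(ltn_trans ll' l'm) //; lia.
  - by rewrite leqnn (ltnW (ltn_trans ll' l'm)).
  - by rewrite eqxx orbT.
pose G := [set j : 'I_k | [&& l < j, j < m & j != l']].
have phase1 : #|restr D @: S| * a ^ #|opened K1 D|
    <= #|restr A @: S| * B ^ k * a ^ #|opened K1 A|.
  apply: (@explore k n b B e B_gt0 e_trans e_swap eB (linked x0) S S_banded S_pattern K1 G A D) => //.
  - by move=> c; rewrite inE => /andP[_ cK]; apply: blocks_linked.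
  (* The block of [l'] consists of [l'] and [m'], and [m'] lies beyond [m]; hence no edge of [G]
     belongs to it. *)
  - move=> j; rewrite inE => /and3P[lj jm jl']; exists (block x0 j); last exact: mem_block.
    rewrite !inE block_in_blocks andbT; apply/eqP => E.
    have := mem_block x0 j; rewrite E => /in_l'; rewrite (negbTE jl') /= => /eqP jm'.
    by move: jm mm'; rewrite jm'; lia.
  move=> A' AA' /properP[_ [j0 j0D j0A']].
  apply/exists_inP; apply: contraT => /exists_inPn H; exfalso.
  have {}H (j j' : 'I_k) : l < j -> j < m -> j != l' -> j' = j.+1 :> nat ->
      (j \in A') = (j' \in A').
    move=> lj jm jl' j'E; have := H j; rewrite inE lj jm jl' => /(_ isT).
    have -> : ordS j = j' by apply: val_inj; rewrite [LHS]ordSE.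
    have -> : j \in D by rewrite !inE (ltnW lj) (ltnW jm).
    have -> : j' \in D by rewrite !inE j'E jm (leqW (ltnW lj)).
    by rewrite /= negbK => /eqP.
  have lA : ordS l \in A' by apply: (subsetP AA'); rewrite !inE eqxx orbT.
  have mA : m \in A' by apply: (subsetP AA'); rewrite !inE eqxx orbT.
  move/negP: j0A'; apply; move: j0D; rewrite !inE => /orP[/andP[lj jm]|/eqP ->]; last first.
    by apply: (subsetP AA'); rewrite !inE eqxx orbT.
  have [lj'|jl] := ltnP l j0.
    apply: (fill_interval ll' l'm H _ mA) => //; last by rewrite lj'.
    move=> j jE; have -> // : j = ordS l.
    by apply: ord_inj; rewrite ordSE// (ltn_trans ll' l'm).
  have -> : j0 = l by apply: ord_inj; apply/eqP; rewrite eqn_leq jl lj.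
  by apply: (subsetP AA'); rewrite !inE eqxx.
have phase2 : #|S| <= #|restr D @: S| * B ^ k * a ^ #|opened K D|.
  by apply: explore_closed; apply/set0Pn; exists (ordS m); rewrite !inE eqxx orbT.
(* Both ends of the edge [l'] lie in [D], so its class is no longer open when the second phase
   begins. *)
have oD : #|opened K D| <= #|opened K1 D|.
  apply/subset_leq_card/subsetP => c; rewrite !inE => /andP[-> oc].
  rewrite oc !andbT; apply: contra oc => /eqP ->; apply/existsP; exists l'.
  apply/and3P; split; rewrite ?mem_block // !inE; apply/orP; left.
    by rewrite (ltnW ll') (ltnW l'm).
  by rewrite ordSE // l'm (leqW (ltnW ll')).
have oA : #|opened K1 A| <= #|K| - 2.
  rewrite (cardsD1 (block x0 l') K) block_in_blocks.
  rewrite (cardsD1 (block x0 l) (K :\ _)) !inE ll'_block block_in_blocks /= addnA addKn.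
  apply/subset_leq_card/subsetP => c; rewrite !inE => /andP[/andP[-> ->] oc].
  rewrite !andbT; apply: contra oc => /eqP ->; apply/existsP; exists l.
  by rewrite mem_block !inE !eqxx !orbT.
(* There are n choices for the first vertex of the edge [l], and by (O1) at most [M] for the other
   three ends. *)
have base : #|restr A @: S| <= n * M.
  pose V := [set u : 'I_n * ('I_n * 'I_n * 'I_n) | e (u.1, u.2.1.1) (u.2.1.2, u.2.2)].
  apply: leq_trans (_ : #|V| <= _).
    apply: (card_restr_le (phi := fun x => (tnth x l, (tnth x (ordS l), tnth x m, tnth x (ordS m))))).
      by move=> x xS; rewrite inE /=; have := S_pattern xS l m; rewrite lm.
    move=> x y xS yS [xy1 xy2 xy3 xy4] j.
    by rewrite !inE => /orP[/orP[/orP[]|]|] /eqP ->.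
  rewrite mulnC -[X in _ <= _ * X]card_ord -cardsT.
  apply: leq_trans (leq_card_fibers (c := M) (f := fst) _) _; last first.
    by rewrite leq_mul2l subset_leq_card ?orbT // subsetT.
  move=> [p t] pt; apply: leq_trans (HM p).
  rewrite -(card_in_imset (f := snd)); last first.
    move=> [p1 t1] [p2 t2]; rewrite !inE /= => /andP[_ /eqP ->] /andP[_ /eqP ->].
    by move=> /= ->.
  apply/subset_leq_card/subsetP => s /imsetP[[p1 t1]]; rewrite !inE /=.
  by move=> /andP[H /eqP E] ->; rewrite -E.
apply: leq_trans phase2 _; rewrite mulnAC.
apply: leq_trans (_ : #|restr D @: S| * a ^ #|opened K1 D| * B ^ k <= _).
  by rewrite leq_mul2r leq_mul2l leq_pexp2l ?orbT.
apply: leq_trans (leq_mul phase1 (leqnn _)) _.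
rewrite (mul2n k) -addnn expnD mulnAC !mulnA; apply: leq_mul.
  by rewrite !leq_mul2r base !orbT.
by rewrite leq_pexp2l.
Qed.

End OnePattern.

Lemma card_few_blocks : 0 < k ->
  #|[set x : walk | banded b x && (2 * #|blocks x| < k)]|
    <= pattern_count * (n * B ^ k * a ^ (k.-1)./2).
Proof.
move=> k0; apply: card_by_pattern => x; rewrite inE => /andP[bx fx].
apply: leq_trans (card_walks_le (x0 := x) _ _ k0) _.
- by move=> y; rewrite !inE => /andP[/andP[]].
- by move=> y; rewrite inE => /andP[_ /eqP /linked_fiber].
(* Fewer than k/2 classes means at most [(k.-1)./2] of them. *)
by rewrite leq_mul2l leq_pexp2l ?orbT //; lia.
Qed.

(** The saved factor [a] stands on the left, which avoids a division. *)
Lemma card_skewed_walks :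
  #|[set x : walk | [&& banded b x, pairing x & skewed x]]| * a
    <= pattern_count * (#|[set t : 'I_n * 'I_n * 'I_n |
         e (t.1.1, t.1.2) (t.1.2, t.2) && (t.2 != t.1.1)]| * B ^ k * a ^ k./2).
Proof.
set S := [set x : walk | _].
have [->|/set0Pn[x0]] := eqVneq S set0; first by rewrite cards0 mul0n.
rewrite inE => /and3P[_ _ /existsP[l0 /existsP[m0 /and4P[lm0 _ _ _]]]].
(* Two different indices force k >= 2, so one factor [a] can be split off. *)
have k2 : 0 < k./2 by have := ltn_ord m0; lia.
rewrite -(prednK k2) expnSr !mulnA leq_mul2r -!mulnA; apply/orP; right.
apply: card_by_pattern => x; rewrite inE => /and3P[bx px].
move=> /existsP[l /existsP[m /and4P[lm llm /eqP sl sm]]].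
have -> : k./2 = #|blocks x| by rewrite -[in LHS](pairing_blocks px) mul2n doubleK.
rewrite mulnA; apply: (@card_skewed_le x _ _ _ l m) => //.
- by move=> y; rewrite !inE => /andP[/and3P[]].
- by move=> y; rewrite inE => /andP[_ /eqP /linked_fiber].
move=> y; rewrite inE => /andP[_ /eqP yx].
by rewrite (linked_fiber yx) (tnth_fiber yx) sm llm; split => //; apply/eqP;
  rewrite (tnth_fiber yx) sl.
Qed.

Lemma card_crossing_walks M :
  (forall p : 'I_n, #|[set t : 'I_n * 'I_n * 'I_n | e (p, t.1.1) (t.1.2, t.2)]| <= M) ->
  #|[set x : walk | [&& banded b x, pairing x & crossing x]]| * a ^ 2
    <= pattern_count * (n * M * B ^ (2 * k) * a ^ k./2).
Proof.
move=> HM; set S := [set x : walk | _].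
have [->|/set0Pn[x0]] := eqVneq S set0; first by rewrite cards0 mul0n.
rewrite inE => /and3P[_ _ /existsP[l0 /existsP[l1 /existsP[m0 /existsP[m1]]]]].
case/and5P=> h1 h2 h3 _ _.
(* Four different indices force k >= 4, so [a ^ 2] can be split off. *)
have k2 : 2 <= k./2 by have := ltn_ord m1; lia.
rewrite -[in X in _ <= X](subnK k2) expnD; move: (a ^ 2) => a2.
rewrite !mulnA leq_mul2r -!mulnA; apply/orP; right.
apply: card_by_pattern => x; rewrite inE => /and3P[bx px].
move=> /existsP[l /existsP[l' /existsP[m /existsP[m' /and5P[g1 g2 g3 g4 g5]]]]].
have -> : k./2 = #|blocks x| by rewrite -[in LHS](pairing_blocks px) mul2n doubleK.
rewrite !mulnA; apply: (@card_crossing_le x _ _ _ l l' m m' M) => //.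
- by move=> y; rewrite !inE => /andP[/and3P[]].
- by move=> y; rewrite inE => /andP[_ /eqP /linked_fiber].
Qed.

End WalkCounts.

(** * Ballot numbers and plane trees *)

(** Number of paths with n steps of size one, up or down, from height h to 0 that never go below 0;
    the recursion splits off the first step. *)
Fixpoint ballot (n h : nat) : nat :=
  if n is n'.+1 then ballot n' h.+1 + (if h is h'.+1 then ballot n' h' else 0)
  else (h == 0).

Lemma ballotS n h :
  ballot n.+1 h = ballot n h.+1 + (if h is h'.+1 then ballot n h' else 0).
Proof. by []. Qed.

Lemma ballot_small n h : n < h -> ballot n h = 0.
Proof.
elim: n h => [|n IH] [|h] //= nh; rewrite !IH //; lia.
Qed.

Lemma ballot_odd n h : odd (n + h) -> ballot n h = 0.
Proof.
elim: n h => [|n IH] [|h] //= nh; rewrite !IH //; lia.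
Qed.

(** The formula of the reflection principle, where h + j is the number of down steps. It is written
    additively to avoid truncated subtraction and follows by induction from Pascal's rule. *)
Lemma ballotE n h j : n = h + 2 * j -> ballot n h + 'C(n, (h + j).+1) = 'C(n, h + j).
Proof.
elim: n h j => [|n IH] h j nE.
  by have [-> ->] : h = 0 /\ j = 0 by lia.
case: j nE => [|j] nE.
  have -> : h = n.+1 by lia.
  rewrite /= ballot_small; last lia.
  have := IH n 0; rewrite !addn0 => /(_ erefl).
  by rewrite !binn !bin_small // !addn0.
have H1 : ballot n h.+1 + 'C(n, (h + j).+2) = 'C(n, (h + j).+1).
  have := IH h.+1 j; rewrite addSn; apply; lia.
case: h nE H1 => [|h] nE H1.
  rewrite /= addn0 !add0n in H1 *.
  rewrite !binS.
  (* Here n = 2j + 1, so the two central coefficients agree. *)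
  have -> : 'C(n, j) = 'C(n, j.+1) by rewrite -bin_sub; [congr 'C(_, _); lia | lia].
  lia.
have H2 : ballot n h + 'C(n, (h + j).+2) = 'C(n, (h + j).+1).
  have := IH h j.+1; rewrite addnS; apply; lia.
rewrite /= !addnS !addSn !binS in H1 *; lia.
Qed.

(** At h = 0 the formula gives C(2j, j) - C(2j, j+1), and (j+1) C(2j, j+1) = j C(2j, j). *)
Lemma ballot_catalan j : j.+1 * ballot (2 * j) 0 = 'C(2 * j, j).
Proof.
have := @ballotE (2 * j) 0 j; rewrite !add0n => /(_ erefl) H.
have := mul_bin_left (2 * j) j; have -> : 2 * j - j = j by lia.
move: H; move: (ballot _ _) 'C(_, _) 'C(_, _) => u v w; nia.
Qed.

Section TupleSum.

Variables (R : Type) (idx : R) (op : Monoid.com_law idx) (T : finType).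

Lemma big_tuple0 (F : 0.-tuple T -> R) : \big[op/idx]_t F t = F [tuple].
Proof. by apply: big_pred1 => t; apply/esym/eqP; apply: tuple0. Qed.

Lemma big_tupleS n (F : n.+1.-tuple T -> R) :
  \big[op/idx]_t F t = \big[op/idx]_x \big[op/idx]_(t : n.-tuple T) F [tuple of x :: t].
Proof.
rewrite pair_big /=.
rewrite (reindex (fun p : T * n.-tuple T => [tuple of p.1 :: p.2])) //=.
exists (fun t => (thead t, [tuple of behead t])) => [[x t] _|t _] /=.
  by rewrite theadE; congr pair; apply: val_inj.
by rewrite -tuple_eta.
Qed.

End TupleSum.

(** * Walks read by a stack along a word *)

Section StackMachine.

Variables (n b : nat).
Notation T := 'I_n.
Notation in_band := (@in_band n b).
Notation a := (2 * b).+1.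

(* A walk is read against a word of up and down steps: an up step pushes the
   new vertex, a down step must return to the vertex just below the top. The
   closing step of the walk is the last letter of the word, so ws is one letter
   longer than ys. *)
Fixpoint good (s : seq T) (ws : seq bool) (ys : seq T) : bool :=
  match ys, ws with
  | [::], _ => (ws == [:: false]) && (size s == 2)
  | y :: ys', true :: ws' => if s is p :: _ then in_band p y && good (y :: s) ws' ys' else false
  | y :: ys', false :: ws' =>
      if s is _ :: s' then (ohead s' == Some y) && good s' ws' ys' else false
  | _, [::] => false
  end.

Fixpoint steps (p : T) (ys : seq T) (z : T) : seq (T * T) :=
  if ys is y :: ys' then (p, y) :: steps y ys' z else [:: (p, z)].

(** Edges in the direction in which they were climbed, from an entry to the one above it; a down
    step walks the swapped edge. *)
Fixpoint stack_edges (s : seq T) : seq (T * T) :=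
  if s is p :: s' then (if s' is q :: _ then (q, p) :: stack_edges s' else [::]) else [::].

Definition swap (u : T * T) := (u.2, u.1).

Lemma size_steps p ys z : size (steps p ys z) = (size ys).+1.
Proof. by elim: ys p => //= y ys IH p; rewrite IH. Qed.

Lemma nth_steps u p ys z t : t < (size ys).+1 ->
  nth u (steps p ys z) t = (nth z (p :: ys) t, nth z (rcons ys z) t).
Proof.
elim: ys p t => [|y ys IH] p [|t] //= ts.
by rewrite IH.
Qed.

(** Every letter changes the height of the stack by one. For a stack of one entry this says that
    half of the letters are up steps. *)
Lemma good_count s ws ys : good s ws ys -> 2 * count id ws + size s = (size ws).+1.
Proof.
elim: ys s ws => [|y ys IH] s [|[] ws] //=.
- by case/andP=> /eqP[-> /eqP ->].
- case: s => // p s /andP[_ /IH] /=; lia.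
- case: s => // p s /andP[_ /IH] /=; lia.
Qed.

Lemma good_banded p s ws ys : good (p :: s) ws ys ->
  all (fun u => in_band u.1 u.2) (stack_edges (p :: s)) ->
  all (fun u => in_band u.1 u.2) (steps p ys (last p s)).
Proof.
elim: ys p s ws => [|y ys IH] p s [|[] ws] //=.
- by case/andP=> _; case: s => [|q []] //= _ /andP[h _]; rewrite in_bandC h.
- move=> /andP[py g] cs; rewrite py /=.
  by apply: (IH y (p :: s) ws) => //=; rewrite py.
- case: s => [|q s] //= /andP[/eqP[<-] g] /andP[qp cs].
  by rewrite in_bandC qp /=; apply: (IH q s ws).
Qed.

(** A down step undoes the edge on top of the stack, which was either there at the start or pushed
    by an earlier up step. The first alternative serves the induction; it is void for a stack of one
    entry. *)
Lemma good_down u0 p s ws ys t : good (p :: s) ws ys -> t < size ws -> ~~ nth true ws t ->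
  swap (nth u0 (steps p ys (last p s)) t) \in stack_edges (p :: s) \/
  exists2 u, u < t /\ nth false ws u &
    nth u0 (steps p ys (last p s)) t = swap (nth u0 (steps p ys (last p s)) u).
Proof.
elim: ys p s ws t => [|y ys IH] p s [|[] ws] t //=.
- case/andP=> /eqP[->]; case: s => [|q []] // _; case: t => //= _ _.
  by left; rewrite inE.
- move=> /andP[py g]; case: t => [|t] //= ts wt.
  case: (IH y (p :: s) ws t g ts wt) => [|[u [ut wu] uE]]; last by right; exists u.+1.
  rewrite inE => /orP[/eqP E|]; last by left.
  right; exists 0 => //=; move: E.
  by case: (nth _ _ _) => c d; rewrite /swap /= => -[-> ->].
- case: s => [|q s] //= /andP[/eqP[<-] g]; case: t => [|t] //= ts wt.
    by left; rewrite inE eqxx.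
  case: (IH q s ws t g ts wt) => [|[u [ut wu] uE]]; last by right; exists u.+1.
  by left; rewrite inE; apply/orP; right.
Qed.

(** The walk ends at the bottom of the stack, so each edge on the stack is undone at some time. *)
Lemma good_return u0 p s ws ys : good (p :: s) ws ys -> forall u, u \in stack_edges (p :: s) ->
  exists2 t, t < size ws & nth u0 (steps p ys (last p s)) t = swap u.
Proof.
elim: ys p s ws => [|y ys IH] p s [|[] ws] //=.
- case/andP=> /eqP[->]; case: s => [|q []] // _ u; rewrite inE => /eqP ->.
  by exists 0.
- move=> /andP[py g] u us; have [|t ts E] := IH y (p :: s) ws g u.
    by rewrite inE; apply/orP; right.
  by exists t.+1.
- case: s => [|q s] //= /andP[/eqP[<-] g] u; rewrite inE => /orP[/eqP ->|us].
    by exists 0.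
  by have [t ts E] := IH q s ws g u us; exists t.+1.
Qed.

Lemma good_up u0 p s ws ys t : good (p :: s) ws ys -> t < size ws -> nth false ws t ->
  exists2 u, t < u < size ws &
    nth u0 (steps p ys (last p s)) u = swap (nth u0 (steps p ys (last p s)) t).
Proof.
elim: ys p s ws t => [|y ys IH] p s [|[] ws] t //=.
- by case/andP=> /eqP[->]; case: t.
- move=> /andP[py g]; case: t => [|t] //= ts wt.
    have [|t ts' E] := good_return u0 g (u := (p, y)); first by rewrite inE eqxx.
    by exists t.+1.
  by have [u uts E] := IH y (p :: s) ws t g ts wt; exists u.+1.
- case: s => [|q s] //= /andP[/eqP[<-] g]; case: t => [|t] //= ts wt.
  by have [u uts E] := IH q s ws t g ts wt; exists u.+1.
Qed.

Definition good_pairs (m : nat) (s : seq T) : nat :=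
  \sum_(ws : m.+1.-tuple bool) \sum_(ys : m.-tuple T) good s ws ys.

Lemma good_pairs0 s : good_pairs 0 s = (size s == 2).
Proof.
rewrite /good_pairs big_tupleS big_bool /=.
by rewrite !big_tuple0 /=.
Qed.

(** Mirrors [ballotS]: after an up step the new top ranges over the band, after a down step it is
    forced. *)
Lemma good_pairsS m p s : good_pairs m.+1 (p :: s) =
  \sum_(y | in_band p y) good_pairs m (y :: p :: s) +
  (if s is _ :: _ then good_pairs m s else 0).
Proof.
rewrite /good_pairs big_tupleS big_bool; congr addn.
  rewrite [LHS](eq_bigr _ (fun ws _ => @big_tupleS nat 0 addn _ _ _)).
  rewrite exchange_big /= [RHS]big_mkcond; apply: eq_bigr => y _ /=.
  by case: ifP => py //=; rewrite big1 // => ws _; rewrite big1.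
rewrite [LHS](eq_bigr _ (fun ws _ => @big_tupleS nat 0 addn _ _ _)).
rewrite exchange_big /=.
case: s => [|q s] /=; first by rewrite big1 // => y _; rewrite big1 // => ws _; rewrite big1.
rewrite (bigD1 q) //= eqxx /= [X in _ + X]big1 ?addn0 // => y yq.
rewrite big1 // => ws _; rewrite big1 // => ys _.
by rewrite (inj_eq Some_inj) eq_sym (negbTE yq).
Qed.

(** The words that lead from height [size s] to 0 are counted by [ballot] and have
    [(m.+1 - size s)./2] up steps, each with at most [a] choices. *)
Lemma good_pairs_le m p s :
  good_pairs m (p :: s) <= ballot m.+1 (size s) * a ^ (m.+1 - size s)./2.
Proof.
elim: m p s => [|m IH] p s.
  rewrite good_pairs0 /= eqSS; case: s => [|q [|r s]] //=.
rewrite good_pairsS ballotS mulnDl; apply: leq_add; last first.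
  case: s => [//|q s]; apply: leq_trans (IH q s) _; rewrite subSS.
  by rewrite leq_mul2l leqnn orbT.
apply: leq_trans (_ : \sum_(y | in_band p y) ballot m.+1 (size s).+1 * a ^ (m.+1 - (size s).+1)./2 <= _).
  by apply: leq_sum => y _; apply: (IH y (p :: s)).
rewrite sum_nat_const.
(* After an up step from so high a stack the ground is out of reach; the ballot number is 0, and the
   truncated exponent does no harm. *)
have [ms|ms] := ltnP m (size s).
  by rewrite ballot_small ?mul0n ?muln0.
have -> : (m.+2 - size s)./2 = ((m.+1 - (size s).+1)./2).+1.
  by rewrite -[RHS]/((m.+1 - (size s).+1).+2)./2; congr half; lia.
rewrite expnS mulnCA leq_mul2l leq_mul2r; apply/orP; right; apply/orP; right.
by apply: leq_trans (card_in_band b p); apply/subset_leq_card/subsetP => y yp; rewrite inE.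
Qed.

Lemma card_in_band_inner (p : T) : b <= p -> p + b < n -> a <= #|in_band p|.
Proof.
move=> bp pn; have ok (i : 'I_a) : p - b + i < n by have := ltn_ord i; lia.
have inj : injective (fun i : 'I_a => Ordinal (ok i)).
  by move=> i j /(congr1 val) /= E; apply: val_inj => /=; lia.
rewrite -[X in X <= _]card_ord -(card_imset _ inj); apply/subset_leq_card/subsetP.
move=> _ /imsetP[i _ ->]; rewrite unfold_in /in_band /=; have := ltn_ord i; lia.
Qed.

(** Each step uses up at most b of the distance to the ends of the index range, so all [a] choices
    stay available at every up step. *)
Lemma good_pairs_ge m p s : (forall q : T, q \in p :: s -> m.+1 * b <= q /\ q + m.+1 * b < n) ->
  ballot m.+1 (size s) * a ^ (m.+1 - size s)./2 <= good_pairs m (p :: s).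
Proof.
elim: m p s => [|m IH] p s inner.
  by rewrite good_pairs0 /= eqSS; case: s {inner} => [|q [|r s]] //=.
rewrite good_pairsS ballotS mulnDl; apply: leq_add; last first.
  case: s inner => [//|q s] inner; apply: leq_trans (IH q s _); rewrite ?subSS //.
  by move=> r rs; have := inner r; rewrite inE rs orbT => /(_ isT); nia.
apply: leq_trans (_ : _ <= \sum_(y | in_band p y) ballot m.+1 (size s).+1 * a ^ (m.+1 - (size s).+1)./2) _;
    last first.
  apply: leq_sum => y py; apply: (IH y (p :: s)) => q; rewrite inE => /orP[/eqP ->|qs].
    have := inner p; rewrite inE eqxx => /(_ isT); move: py; rewrite /in_band; nia.
  by have := inner q qs; nia.
rewrite sum_nat_const.
have [ms|ms] := ltnP m (size s).
  by rewrite ballot_small ?mul0n ?muln0.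
have -> : (m.+2 - size s)./2 = ((m.+1 - (size s).+1)./2).+1.
  by rewrite -[RHS]/((m.+1 - (size s).+1).+2)./2; congr half; lia.
rewrite expnS mulnCA leq_mul2r; apply/orP; right.
have [|h1 h2] := inner p; first by rewrite inE eqxx.
by apply: card_in_band_inner; nia.
Qed.

End StackMachine.

(** * Edge classes of walks that the stack accepts *)

Section GoodWalks.

Variables (k' n b : nat) (e : rel ('I_n * 'I_n)).
Notation k := k'.+1.
Notation walk := (k.-tuple 'I_n).
Notation a := (2 * b).+1.
Hypothesis e_equiv : equivalence_rel e.
Hypothesis e_swap : forall p q, e (p, q) (q, p).

Definition good_walk (x : walk) (w : k.-tuple bool) := good b [:: thead x] w (behead x).

(** The candidate word of a walk: up at the first edge of a class, down at the later ones. *)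
Definition first_word (x : walk) : k.-tuple bool :=
  [tuple ~~ [exists u : 'I_k, (u < t) && linked e x u t] | t < k].

Lemma val_ordS (l : 'I_k) : l < k' -> ordS l = l.+1 :> nat.
Proof. by move=> lk; rewrite /= modn_small. Qed.

Lemma edge_steps u0 (x : walk) (l : 'I_k) :
  nth u0 (steps (thead x) (behead x) (thead x)) l = edge x l.
Proof.
rewrite nth_steps; last by rewrite size_behead size_tuple.
congr pair.
  by case/tupleP: x => p ys; rewrite theadE /= -[p :: _]/(tval [tuple of p :: ys]) -tnth_nth.
have [lk|lk] := ltnP l k'.
  rewrite nth_rcons size_behead size_tuple lk nth_behead.
  by rewrite (tnth_nth (thead x)) val_ordS.
have lE : l = k' :> nat by have := ltn_ord l; lia.
rewrite nth_rcons size_behead size_tuple lE /= ltnn eqxx.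
by rewrite /thead; congr tnth; apply: val_inj; rewrite /= lE modnn.
Qed.

Lemma count_tuple (w : k.-tuple bool) : count id w = #|[set t | tnth w t]|.
Proof.
rewrite -sum1_count big_tuple sum1dep_card; apply: eq_card => t.
by rewrite !inE.
Qed.

Lemma good_walkP x w : good_walk x w ->
  [/\ banded b x, 2 * #|[set t | tnth w t]| = k,
      (forall t : 'I_k, ~~ tnth w t ->
         exists2 u : 'I_k, u < t & tnth w u /\ edge x t = swap (edge x u)) &
      (forall t : 'I_k, tnth w t ->
         exists2 u : 'I_k, t < u & edge x u = swap (edge x t))].
Proof.
move=> g; pose u0 := (thead x, thead x); split.
- have := good_banded g isT => /(all_nthP u0) H.
  apply/forallP => l; have := H l.
  by rewrite edge_steps size_steps size_behead size_tuple ltn_ord => /(_ isT).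
- by have := good_count g; rewrite count_tuple size_tuple /= addn1 => -[].
- move=> t wt; have := good_down u0 (t := t) g.
  rewrite size_tuple ltn_ord -tnth_nth => /(_ isT wt) [//|[u [ut wu]]].
  have uk : u < k by rewrite (ltn_trans ut).
  rewrite edge_steps (edge_steps u0 x (Ordinal uk)) => E.
  exists (Ordinal uk) => //; split => //.
  by rewrite (tnth_nth false).
- move=> t wt; have := good_up u0 (t := t) g.
  rewrite size_tuple ltn_ord -tnth_nth => /(_ isT wt) [u /andP[tu uk]].
  rewrite edge_steps (edge_steps u0 x (Ordinal uk)) => E.
  by exists (Ordinal uk).
Qed.

Lemma linked_swap (x : walk) l m : edge x m = swap (edge x l) -> linked e x l m.
Proof. by rewrite /linked => ->; rewrite /swap /edge. Qed.

(** A down step is linked to the earlier up step that it undoes, so each class contains an up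
    step. *)
Lemma good_blocks x w : good_walk x w -> blocks e x = block e x @: [set t | tnth w t].
Proof.
move=> /good_walkP[_ _ dn _]; apply/setP => c; apply/idP/imsetP; last first.
  by case=> t _ ->; apply: block_in_blocks.
move=> /(blocksP e)[l ->].
have [N] := ubnP l; elim: N l => // N IH l lN.
have [wl|wl] := boolP (tnth w l); first by exists l; rewrite ?inE.
have [u ul [wu /linked_swap/(eq_block e_equiv) <-]] := dn l wl.
by apply: IH; apply: leq_trans ul _.
Qed.

Lemma good_blocks_le x w : good_walk x w -> 2 * #|blocks e x| <= k.
Proof.
move=> g; have [_ ups _ _] := good_walkP g; rewrite -[X in _ <= X]ups.
by rewrite (good_blocks g) leq_mul2l leq_imset_card.
Qed.

(** With k/2 up steps and as many classes, the up steps represent the classes one by one. Each class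
    then consists of an up step and the step that undoes it, and this determines the word. *)
Lemma good_full x w : good_walk x w -> 2 * #|blocks e x| = k ->
  [/\ w = first_word x, pairing e x &
      forall l m, linked e x l m -> edge x m = edge x l \/ edge x m = swap (edge x l)].
Proof.
move=> g full; have [_ ups dn up] := good_walkP g.
have /imset_injP inj : #|block e x @: [set t | tnth w t]| == #|[set t | tnth w t]|.
  by rewrite -(good_blocks g) -(eqn_pmul2l (m := 2)) // full ups.
have binj t u : tnth w t -> tnth w u -> linked e x t u -> t = u.
  by move=> wt wu tu; apply: inj; rewrite ?inE // (eq_block e_equiv tu).
have up_block (l : 'I_k) : exists2 t : 'I_k, t <= l & tnth w t /\ block e x l = block e x t.
  have [N] := ubnP l; elim: N l => // N IH l lN.
  have [wl|wl] := boolP (tnth w l); first by exists l.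
  have [u ul [wu /linked_swap/(eq_block e_equiv) <-]] := dn l wl.
  by exists u; rewrite // ltnW.
have linkedP l m : block e x l = block e x m -> linked e x m l.
  by move=> E; have := mem_block e_equiv x l; rewrite E inE.
have sz2 l : 1 < #|block e x l|.
  have [t _ [wt ->]] := up_block l; have [u tu E] := up t wt.
  rewrite (cardsD1 t) (mem_block e_equiv) add1n ltnS card_gt0; apply/set0Pn; exists u.
  rewrite !inE (linked_swap E) andbT; apply: contraTneq tu => ->; by rewrite ltnn.
have px : pairing e x.
  by have := few_blocks_or_pairing e_equiv sz2; rewrite full ltnn.
split=> //.
  apply: eq_from_tnth => t; rewrite tnth_mktuple; apply/idP/negP => [wt /existsP[u /andP[ut lu]]|].
    (* The block of [u] contains an up step [s <= u]; injectivity forces [s = t], against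
       [u < t]. *)
    have [s su [ws sE]] := up_block u.
    have : s = t.
      by apply: binj => //; apply: linkedP; rewrite -(eq_block e_equiv lu).
    by move=> E; move: su; rewrite E leqNgt ut.
  apply: contra_notT => wt; have [u ut [wu E]] := dn t wt.
  by apply/existsP; exists u; rewrite ut linked_swap.
move=> l m lm; have [t _ [wt tE]] := up_block l; have [u tu E] := up t wt.
have tu' : t != u by apply: contraTneq tu => ->; rewrite ltnn.
(* Blocks have two elements, so the up step [t] and the step [u] undoing it exhaust this one. *)
have tb : [set t; u] = block e x t.
  apply/eqP; rewrite eqEcard cards2 tu' (eqP (forallP px t)) andbT.
  apply/subsetP => j; rewrite !inE => /orP[] /eqP ->; last exact: linked_swap.
  by have := mem_block e_equiv x t; rewrite inE.
have lt : l \in [set t; u] by rewrite tb -tE mem_block.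
have mt : m \in [set t; u] by rewrite tb -tE inE.
move: lt mt; rewrite !inE => /orP[] /eqP -> /orP[] /eqP ->; rewrite ?E; auto.
Qed.

(** * Noncrossing pairings are accepted by the stack *)

Section Simulation.

Variable x : walk.
Hypotheses (x_banded : banded b x) (x_pairing : pairing e x).
Hypotheses (x_crossing : ~~ crossing e x) (x_skewed : ~~ skewed e x).

(** The partner of [l] in its pair; the default [l] never occurs, by [pt_linked]. *)
Let pt (l : 'I_k) := odflt l [pick m in block e x l :\ l].

Let pt_linked l : pt l != l /\ linked e x l (pt l).
Proof.
rewrite /pt; case: pickP => [m|no] /=; first by rewrite !inE => /andP[].
have := eqP (forallP x_pairing l); rewrite (cardsD1 l) (mem_block e_equiv).
by rewrite (eq_card0 no).
Qed.

Let pt_uniq l m : linked e x l m -> m != l -> m = pt l.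
Proof.
move=> lm ml; have [pl lpl] := pt_linked l.
have E : [set l; pt l] = block e x l.
  apply/eqP; rewrite eqEcard cards2 eq_sym pl (eqP (forallP x_pairing l)) andbT.
  apply/subsetP => j; rewrite !inE => /orP[] /eqP -> //.
  by have := mem_block e_equiv x l; rewrite inE.
have : m \in [set l; pt l] by rewrite E inE.
by rewrite !inE (negbTE ml) => /eqP.
Qed.

Let ptK l : pt (pt l) = l.
Proof.
have [pl lpl] := pt_linked l; apply/esym/pt_uniq; last by rewrite eq_sym.
by have := equivalence_sym e_equiv (edge x l) (edge x (pt l)); rewrite -/(linked e x _ _) lpl.
Qed.

(** The stack that belongs to a list of open steps: their end points above the starting vertex. *)
Let stk (L : seq 'I_k) := [seq tnth x (ordS l) | l <- L] ++ [:: thead x].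
Let top L := head (thead x) (stk L).
(** Each open step starts at the end of the next older one, so popping it uncovers its own starting
    point. *)
Let Fixpoint chain (L : seq 'I_k) : Prop :=
  if L is l :: L' then tnth x l = top L' /\ chain L' else True.

Let stk_top L : exists s, stk L = top L :: s.
Proof. by case: L => [|l L]; eexists. Qed.

Let wE (t : 'I_k) : tnth (first_word x) t = (t < pt t).
Proof.
rewrite tnth_mktuple; have [pn lp] := pt_linked t.
apply/idP/idP => [/existsPn/(_ (pt t))|tp].
  rewrite negb_and; have -> : linked e x (pt t) t.
    by have := pt_linked (pt t); rewrite ptK => -[].
  rewrite orbF -leqNgt leq_eqVlt => /orP[/eqP E|//].
  by case/eqP: pn; apply: val_inj.
apply/existsPn => u; apply/negP => /andP[ut lu].
have : t = pt u by apply: pt_uniq => //; apply: contraTneq ut => ->; rewrite ltnn.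
by move=> E; move: tp ut; rewrite E ptK; lia.
Qed.

(* L lists the open steps at time t, the most recent first. *)
Let simulate d : forall (t : 'I_k) (L : seq 'I_k), t + d = k' ->
  (forall l, (l \in L) = (l < t) && (t <= pt l)) ->
  sorted gtn (map val L) -> chain L -> tnth x t = top L ->
  good b (stk L) (drop t (first_word x)) (drop t.+1 x).
Proof.
have uniqL (L : seq 'I_k) : sorted gtn (map val L) -> uniq L.
  move=> sL; rewrite -(map_inj_uniq val_inj); apply: (sorted_uniq _ _ sL).
  - by move=> p q r qp rq; apply: ltn_trans rq qp.
  - by move=> p; rewrite /= ltnn.
elim: d => [|d IH] t L td memL sL cL tL.
  rewrite [X in good _ _ _ X]drop_oversize ?size_tuple; last by move: td; lia.
  have pt_t : pt t < t.
    have [pn _] := pt_linked t; have := ltn_ord (pt t).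
    have : (pt t : nat) <> t by move/val_inj/eqP; rewrite (negbTE pn).
    move: td; lia.
  rewrite (drop_nth false) ?size_tuple // -tnth_nth wE ltnNge (ltnW pt_t).
  rewrite drop_oversize ?size_tuple; last by move: td; lia.
  rewrite /= /stk size_cat size_map addn1 eqSS.
  (* At the last time t a step still open has its partner at t itself, so exactly one is open and
     the stack has two entries. *)
  have mem1 l : (l \in L) = (l \in [:: pt t]).
    rewrite memL inE; apply/idP/eqP => [/andP[lt tl]|->]; last by rewrite ptK pt_t leqnn.
    have E : pt l = t by apply: ord_inj; have := ltn_ord (pt l); move: td tl; lia.
    by rewrite -E ptK.
  by rewrite (perm_size (uniq_perm (uniqL L sL) (isT : uniq [:: pt t]) mem1)).
have tk : t < k' by move: td; lia.
have St := val_ordS tk.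
have td' : ordS t + d = k' by rewrite St addSnnS.
rewrite (drop_nth false) ?size_tuple // -tnth_nth -St.
rewrite (drop_nth (thead x) (s := x)) ?size_tuple // -tnth_nth wE.
have [pn lp] := pt_linked t.
have [tp|tp] := ltnP t (pt t).
  have mem' l : (l \in t :: L) = (l < ordS t) && (ordS t <= pt l).
    rewrite inE memL St ltnS; apply/orP/andP => [[/eqP ->|/andP[lt tl]]|[]].
    - by rewrite leqnn tp.
    - rewrite (ltnW lt) ltn_neqAle tl andbT; split => //; apply/negP => /eqP/ord_inj E.
      by move: tp lt; rewrite E ptK; lia.
    - rewrite leq_eqVlt => /orP[/eqP/ord_inj -> _|-> /ltnW ->]; last by right.
      by left.
  have sorted' : sorted gtn (map val (t :: L)).
    rewrite /= path_min_sorted // all_map; apply/allP => l /=.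
    by rewrite memL => /andP[].
  have := IH (ordS t) (t :: L) td' mem' sorted' (conj tL cL) erefl.
  have -> : stk (t :: L) = tnth x (ordS t) :: stk L by [].
  have [s ->] := stk_top L; rewrite -tL => g.
  by apply/andP; split; [exact: (forallP x_banded t)|exact: g].
have lt : pt t < t.
  by rewrite ltn_neqAle tp andbT; apply: contra pn => /eqP/ord_inj ->.
have lL : pt t \in L by rewrite memL lt ptK leqnn.
case: L memL sL cL tL lL => [//|l0 L] memL sL [cl0 cL] tL lL.
(* The partner of [t] is on top: a later open step [l0] would give the crossing
   [pt t < l0 < t < pt l0]. *)
have E0 : l0 = pt t.
  apply/eqP; move: lL; rewrite inE eq_sym => /orP[//|lL].
  have l0gt : pt t < l0.
    move: sL; rewrite /= (path_sortedE (rev_trans ltn_trans)) all_map => /andP[/allP/(_ _ lL)] //.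
  have := memL l0; rewrite inE eqxx => /esym/andP[l0t tpl0].
  have tpl0' : t < pt l0.
    rewrite ltn_neqAle tpl0 andbT; apply/negP => /eqP/ord_inj E.
    by move: l0gt; rewrite E ptK ltnn.
  case/negP: x_crossing; apply/existsP; exists (pt t); apply/existsP; exists l0.
  apply/existsP; exists t; apply/existsP; exists (pt l0); apply/and5P; split => //.
    by have := pt_linked (pt t); rewrite ptK => -[].
  by have [] := pt_linked l0.
(* The step [t] leaves from the end of [l0]; as the walk is not skewed, it returns to the start of
   [l0]. *)
have xl0 : tnth x l0 = tnth x (ordS t).
  apply/eqP; apply: contraNT x_skewed => ne; apply/existsP; exists l0; apply/existsP; exists t.
  rewrite ne andbT E0 lt /=; apply/andP; split.
    by have := pt_linked (pt t); rewrite ptK => -[].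
  by rewrite tL -E0.
have uL := uniqL _ sL; rewrite cons_uniq in uL; case/andP: uL => l0L uL.
have mem' l : (l \in L) = (l < ordS t) && (ordS t <= pt l).
  rewrite St ltnS; apply/idP/andP => [lL'|[lt' tl]].
    have := memL l; rewrite inE lL' orbT => /esym/andP[lt' tl].
    split; first exact: ltnW.
    rewrite ltn_neqAle tl andbT; apply/negP => /eqP/ord_inj E.
    by move: l0L; rewrite E0 E ptK lL'.
  have lnt : l != t by apply: contraTneq tl => ->; rewrite -ltnNge.
  have : l \in l0 :: L.
    rewrite memL (ltnW tl) andbT ltn_neqAle lt' andbT.
    by apply: contra lnt => /eqP/ord_inj ->.
  by rewrite inE => /orP[/eqP El|//]; move: tl; rewrite El E0 ptK ltnn.
have sorted' : sorted gtn (map val L) by move: sL => /= /path_sorted.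
have g := IH (ordS t) L td' mem' sorted' cL (etrans (esym xl0) cl0).
apply/andP; split; last exact: g.
change (ohead (stk L) == Some (tnth x (ordS t))).
by have [s ->] := stk_top L; rewrite /= -cl0 xl0.
Qed.

Lemma good_first_word : good_walk x (first_word x).
Proof.
have := @simulate k' ord0 [::] erefl; rewrite drop0 drop1; apply=> //.
Qed.

End Simulation.
End GoodWalks.

(** * Counting tree walks *)

Section TreeWalks.

Variables (k' n b : nat) (e : rel ('I_n * 'I_n)).
Notation k := k'.+1.
Notation walk := (k.-tuple 'I_n).
Notation a := (2 * b).+1.
Hypothesis e_equiv : equivalence_rel e.
Hypothesis e_swap : forall p q, e (p, q) (q, p).

Definition tree_walks : {set walk} :=
  [set x | [&& banded b x, pairing e x & good_walk b x (first_word e x)]].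

Let good_set := [set p : walk * k.-tuple bool | good_walk b p.1 p.2].

Let card_good_set : #|good_set| = \sum_(x0 : 'I_n) good_pairs b k' [:: x0].
Proof.
rewrite -sum1dep_card big_mkcond /= -(pair_big predT predT (fun x w => if good_walk b x w then 1 else 0)) /=.
rewrite big_tupleS; apply: eq_bigr => x0 _; rewrite exchange_big /=.
apply: eq_bigr => w _; apply: eq_bigr => ys _.
by rewrite /good_walk theadE /=; case: good.
Qed.

(** Attaching [first_word] to a tree walk embeds the tree walks into the pairs counted by
    [good_pairs]. *)
Lemma card_tree_walks_le : #|tree_walks| <= n * (ballot k 0 * a ^ k./2).
Proof.
apply: leq_trans (_ : #|good_set| <= _); last first.
  rewrite card_good_set -[X in _ <= X * _]card_ord -sum_nat_const.
  by apply: leq_sum => x0 _; apply: leq_trans (good_pairs_le _ _ _ _) _; rewrite subn0.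
rewrite -(card_imset (f := fun x => (x, first_word e x))); last by move=> x y [].
apply/subset_leq_card/subsetP => _ /imsetP[x xt ->].
by move: xt; rewrite !inE => /and3P[].
Qed.

(** Starting vertices at distance at least kb from both ends of the index range have the full number
    of pairs. By [good_full], a pair that does not come from a tree walk has fewer than k/2 classes,
    and each such walk has at most [2 ^ k] words. *)
Lemma card_tree_walks_ge :
  (n - 2 * k * b) * (ballot k 0 * a ^ k./2)
    <= #|tree_walks| + #|[set x : walk | banded b x && (2 * #|blocks e x| < k)]| * 2 ^ k.
Proof.
apply: leq_trans (_ : #|good_set| <= _).
  pose inner := [set p : 'I_n | (k * b <= p) && (p + k * b < n)].
  apply: leq_trans (_ : #|inner| * (ballot k 0 * a ^ k./2) <= _).
    rewrite leq_mul2r; apply/orP; right.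
    have [nk|nk] := leqP n (2 * k * b); first by move: nk; rewrite -subn_eq0 => /eqP ->.
    have ok (i : 'I_(n - 2 * k * b)) : k * b + i < n by have := ltn_ord i; lia.
    have inj : injective (fun i => Ordinal (ok i)).
      by move=> i j /(congr1 val) /= E; apply: val_inj => /=; lia.
    rewrite -[X in X <= _]card_ord -(card_imset _ inj); apply/subset_leq_card/subsetP.
    by move=> _ /imsetP[i _ ->]; rewrite inE /=; have := ltn_ord i; lia.
  rewrite card_good_set -sum_nat_const [X in _ <= X](bigID (mem inner)) /=.
  apply: leq_trans (leq_addr _ _); apply: leq_sum => p; rewrite inE => /andP[p1 p2].
  have := @good_pairs_ge n b k' p [::]; rewrite [size _]/= subn0; apply.
  by move=> q; rewrite inE => /eqP ->.
pose few := [set x : walk | banded b x && (2 * #|blocks e x| < k)].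
pose img := (fun x => (x, first_word e x)) @: tree_walks.
apply: leq_trans (_ : #|img :|: setX few setT| <= _); last first.
  rewrite cardsU; apply: leq_trans (leq_subr _ _) _.
  rewrite cardsX cardsT card_tuple card_bool leq_add2r; exact: leq_imset_card.
apply/subset_leq_card/subsetP => -[x w]; rewrite !inE /= andbT => g.
have [bx _ _ _] := good_walkP g.
have := good_blocks_le e_equiv e_swap g; rewrite leq_eqVlt => /orP[/eqP full|->].
  have [wE px _] := good_full e_equiv e_swap g full.
  by apply/orP; left; apply/imsetP; exists x; rewrite ?inE ?bx ?px -?wE.
by rewrite bx orbT.
Qed.

Lemma walk_cases x : banded b x -> (forall l, 1 < #|block e x l|) ->
  [|| 2 * #|blocks e x| < k, pairing e x && crossing e x, pairing e x && skewed e x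
    | x \in tree_walks].
Proof.
move=> bx sz2; have := few_blocks_or_pairing e_equiv sz2.
case/orP=> [-> //|px]; rewrite px.
have [cx|ncx] := boolP (crossing e x); first by rewrite orbT.
have [sx|nsx] := boolP (skewed e x); first by rewrite !orbT.
by rewrite inE bx px good_first_word ?orbT.
Qed.

Lemma tree_walksP x : x \in tree_walks ->
  pairing e x /\ forall l m, linked e x l m -> edge x m = edge x l \/ edge x m = swap (edge x l).
Proof.
rewrite inE => /and3P[bx px g]; split => //.
by have [] := good_full e_equiv e_swap g (pairing_blocks e_equiv px).
Qed.

End TreeWalks.

(* Imported only here: classical_sets shadows set0, setT and many other names of finset. *)
From mathcomp Require Import all_order all_algebra.
From mathcomp Require Import all_classical all_reals all_analysis measurable_realfun.
From mathcomp Require Import ring lra.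
Import Order.TTheory GRing.Theory Num.Theory.
Import numFieldNormedType.Exports.
Local Open Scope classical_set_scope.

Local Open Scope ring_scope.

(** * Independence and walk moments *)

Section Independence.

Context d (T : measurableType d) (R : realType) (P : probability T R).

Import HBNNSimple.

(** The hypothesis covers the level sets of simple functions of [Y]; monotone convergence gives the
    rest. *)
Lemma integralM_of_indicators (Y Z : T -> R) (c : R) :
  measurable_fun setT Y -> measurable_fun setT Z ->
  (forall w, 0 <= Y w) -> (forall w, 0 <= Z w) -> 0 <= c ->
  (forall B : set R, measurable B ->
     (\int[P]_w (\1_(Y @^-1` B) w * Z w)%:E = P (Y @^-1` B) * c%:E)%E) ->
  (\int[P]_w (Y w * Z w)%:E = \int[P]_w (Y w)%:E * c%:E)%E.
Proof.
move=> mY mZ Y0 Z0 c0 ind.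
(* The identity of R, cut off at 0, is approximated instead of [Y]: composing with [Y] gives simple
   functions whose level sets are preimages under [Y]. *)
have mf : measurable_fun setT (EFin \o (fun r : R => Num.max r 0) : R -> \bar R).
  exact/measurable_EFinP/measurable_maxr.
pose f_ := nnsfun_approx (@measurableT _ R) mf.
have mfY n : measurable_fun setT (f_ n \o Y) by exact: measurableT_comp.
have cvgf w : (f_ n (Y w))%:E @[n --> \oo] --> (Y w)%:E.
  have := @cvg_nnsfun_approx _ R R setT measurableT _ mf _ (Y w) I.
  rewrite /= (max_idPl (Y0 w)); apply.
  by move=> r _; rewrite lee_fin le_max lexx orbT.
have mono (V : T -> R) : measurable_fun setT V -> (forall w, 0 <= V w) ->
    (\int[P]_w (Y w * V w)%:E = limn (fun n => \int[P]_w (f_ n (Y w) * V w)%:E))%E.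
  move=> mV V0; rewrite -monotone_convergence//.
  - apply: eq_integral => w _; apply/esym/cvg_lim => //.
    rewrite (_ : (fun n => _) = (fun n => ((V w)%:E * (f_ n (Y w))%:E)%E)); last first.
      by apply/funext => n; rewrite -EFinM mulrC.
    by rewrite mulrC EFinM; apply: cvgeZl => //; exact: cvgf.
  - by move=> n; apply/measurable_EFinP; exact: (measurable_funM (mfY n) mV).
  - by move=> n w _; rewrite lee_fin mulr_ge0.
  - move=> w _ m n mn; rewrite lee_fin ler_wpM2r//.
    exact/lefP/nd_nnsfun_approx.
transitivity (\int[P]_w (Y w * c)%:E)%E; last first.
  under eq_integral do rewrite EFinM.
  rewrite ge0_integralZr//.
  - exact/measurable_EFinP.
  - by move=> w _; rewrite lee_fin.
rewrite (mono Z)// (mono (cst c))//; congr (limn _); apply/funext => n.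
have expand (V : T -> R) : measurable_fun setT V -> (forall w, 0 <= V w) ->
    (\int[P]_w (f_ n (Y w) * V w)%:E =
     \sum_(r \in range (f_ n)) r%:E * \int[P]_w (\1_(Y @^-1` (f_ n @^-1` [set r])) w * V w)%:E)%E.
  move=> mV V0.
  have mI r : measurable_fun setT (\1_(Y @^-1` (f_ n @^-1` [set r])) : T -> R).
    by apply: measurable_indic; rewrite -[X in measurable X]setTI; exact: mY.
  transitivity (\int[P]_w (\sum_(r \in range (f_ n))
      (r * (\1_(Y @^-1` (f_ n @^-1` [set r])) w * V w))%:E))%E.
    apply: eq_integral => w _; rewrite fimfunE mulr_fsuml// -fsumEFin//.
    by apply: eq_fsbigr => r _; rewrite mulrA.
  rewrite ge0_integral_fsum//.
  - apply: eq_fsbigr => r; rewrite inE => -[s _ <-].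
    under eq_integral do rewrite EFinM.
    rewrite ge0_integralZl// ?lee_fin//.
    + by apply/measurable_EFinP; apply: measurable_funM.
    + by move=> w _; rewrite lee_fin mulr_ge0.
  - move=> r; apply/measurable_EFinP; do 2 apply: measurable_funM => //.
  - move=> r w _; rewrite lee_fin mulrA mulr_ge0//.
    by rewrite indicE; case: (boolP (_ \in _)); rewrite ?mulr0// inE /= mulr1 => <-.
rewrite (expand Z)// (expand (cst c))//; apply: eq_fsbigr => r _; congr (_ * _)%E.
have mI : measurable (Y @^-1` (f_ n @^-1` [set r])).
  by rewrite -[X in measurable X]setTI; exact: mY.
rewrite ind//; under eq_integral do rewrite EFinM /=.
rewrite ge0_integralZr//; last exact/measurable_EFinP/measurable_indic.
by rewrite integral_indic ?setIT.
Qed.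

Variables (K : finType) (I : {set K}) (F : K -> set (set T)).
Hypothesis F_indep : mutually_independent P I F.
Hypothesis F_meas : forall i A, F i A -> measurable A.

Definition meas_wrt (i : K) (g : T -> R) := forall B : set R, measurable B -> F i (g @^-1` B).

Lemma meas_wrt_measurable i g : meas_wrt i g -> measurable_fun setT g.
Proof. by move=> mg _ B mB; rewrite setTI; apply: (F_meas (i := i)); exact: mg. Qed.

(** Induction on the size of [J], the indices whose factor may be a general nonnegative function
    rather than an indicator. *)
Lemma independent_ge0_integral_prod (J : {set K}) (g : K -> T -> R) (c : K -> R) :
  (forall i, i \in I -> if i \in J then meas_wrt i (g i) /\ (forall w, 0 <= g i w)
             else exists2 A, F i A & g i = \1_A) ->
  (forall i, i \in I -> (\int[P]_w (g i w)%:E = (c i)%:E)%E) ->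
  (\int[P]_w (\prod_(i in I) g i w)%:E = (\prod_(i in I) c i)%:E)%E.
Proof.
elim: {J}_.+1 {-2}J (ltnSn #|J|) g c => // m IH J Jm g c gJ gc.
(* With indicators only, the product is the indicator of an intersection, and the claim is the
   definition of independence. *)
have [J0|/set0Pn[j jJ]] := eqVneq (J :&: I)%SET finset.set0.
  have /choice[A AE] : forall i, exists A, i \in I -> F i A /\ g i = \1_A.
    move=> i; have [iI|iI] := boolP (i \in I); last by exists setT.
    have := gJ i iI; have -> : (i \in J) = false.
      by apply: contra_eqF J0 => iJ; apply/finset.set0Pn; exists i; rewrite finset.inE iJ.
    by case=> B FB gB; exists B.
  have -> : (\prod_(i in I) c i)%:E = (\prod_(i in I) P (A i))%E.
    rewrite -prodEFin; apply: eq_bigr => i iI; rewrite -gc//.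
    have [FA ->] := AE i iI; rewrite integral_indic ?setIT//; exact: F_meas FA.
  rewrite -F_indep; last by move=> i iI; have [] := AE i iI.
  have mcap : measurable (\bigcap_(i in [set i | i \in I]) A i).
    apply: fin_bigcap_measurable; first exact: finite_finset.
    by move=> i iI; have [FA _] := AE i iI; exact: F_meas FA.
  rewrite -[in RHS](setIT (\bigcap_(i in _) _)) -integral_indic//.
  apply: eq_integral => w _; congr EFin; rewrite indicE.
  have [wA|wA] := boolP (w \in _).
    rewrite big1// => i iI; have [_ ->] := AE i iI; rewrite indicE mem_set//.
    by move: wA; rewrite inE; apply.
  have [i [iI Aiw]] : exists i, i \in I /\ ~ A i w.
    apply: contrapT => H; move/negP: wA; apply; rewrite inE => i iI.
    by apply: contrapT => Aiw; apply: H; exists i.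
  rewrite (bigD1 i)//=; have [_ ->] := AE i iI.
  by rewrite indicE memNset// mul0r.
rewrite finset.inE in jJ; case/andP: jJ => jJ jI.
have := gJ j jI; rewrite jJ => -[mgj gj0].
have g_meas i : i \in I -> measurable_fun setT (g i) /\ forall w, 0 <= g i w.
  move=> iI; have := gJ i iI; case: ifP => _ [].
    by move=> mgi gi0; split=> //; exact: meas_wrt_measurable mgi.
  move=> A FA ->; split=> [|w]; last by rewrite indicE.
  by apply: measurable_indic; exact: F_meas FA.
pose Z w := \prod_(i in I | i != j) g i w.
pose C := \prod_(i in I | i != j) c i.
have Z0 w : 0 <= Z w by apply: prodr_ge0 => i /andP[/g_meas[_ gi0] _].
have C0 : 0 <= C.
  apply: prodr_ge0 => i /andP[iI _]; rewrite -lee_fin -gc//.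
  by apply: integral_ge0 => w _; rewrite lee_fin; have [_] := g_meas i iI.
have mZ : measurable_fun setT Z.
  rewrite /Z; under eq_fun do rewrite -big_filter.
  apply: measurable_prod => i; rewrite mem_filter => /andP[/andP[iI _] _].
  by have [] := g_meas i iI.
under eq_integral do rewrite (bigD1 j)//=.
rewrite (bigD1 j)//= EFinM -gc//.
(* This replaces [g j] by the indicator of one of its events, which takes [j] out of [J]. *)
apply: integralM_of_indicators => //; first exact: meas_wrt_measurable mgj.
move=> B mB; set A := g j @^-1` B.
have FA : F j A by exact: mgj.
have Afin : P A \is a fin_num by rewrite fin_num_measure//; exact: F_meas FA.
pose g' i := if i == j then \1_A else g i.
pose c' i := if i == j then fine (P A) else c i.
have := IH (J :\ j)%SET _ g' c'; rewrite (bigD1 j)//= /c' eqxx EFinM fineK//.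
rewrite [X in (P A * X%:E)%E](eq_bigr c); last by move=> i /andP[_ /negbTE ->].
move=> <-.
- apply: eq_integral => w _; rewrite [in RHS](bigD1 j)//= /g' eqxx; congr (_ * _)%:E.
  by apply: eq_bigr => i /andP[_ /negbTE ->].
- by move: Jm; rewrite (finset.cardsD1 j) jJ.
- move=> i iI; rewrite finset.in_setD1 /g'; case: eqP => [->|_] /=; last exact: gJ.
  by exists A.
- move=> i iI; rewrite /g'; case: eqP => [_|_]; last exact: gc.
  by rewrite integral_indic ?setIT ?fineK//; exact: F_meas FA.
Qed.


(** Each factor is split into positive and negative part; the product expands over the choices of
    sign, and every summand is a product of nonnegative functions. *)
Lemma independent_integral_prod (g : K -> T -> R) (c : K -> R) :
  (forall i, i \in I -> meas_wrt i (g i)) ->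
  (forall i, i \in I -> P.-integrable setT (EFin \o g i)) ->
  (forall i, i \in I -> (\int[P]_w (g i w)%:E = (c i)%:E)%E) ->
  (\int[P]_w (\prod_(i in I) g i w)%:E = (\prod_(i in I) c i)%:E)%E.
Proof.
move=> mg ig gc.
pose part (s : bool) (r : R) := if s then Num.max (- r) 0 else Num.max r 0.
pose sgn (s : bool) : R := if s then -1 else 1.
have partE r : r = \sum_(s : bool) sgn s * part s r.
  rewrite big_bool /sgn /part /= mulN1r mul1r; have [r0|r0] := boolP (0 <= r).
    have nr0 : - r <= 0 by rewrite oppr_le0.
    by rewrite (max_idPl r0) (max_idPr nr0) oppr0 add0r.
  have {}r0 : r <= 0 by rewrite ltW// ltNge.
  have nr0 : 0 <= - r by rewrite oppr_ge0.
  by rewrite (max_idPr r0) (max_idPl nr0) opprK addr0.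
have part0 s r : 0 <= part s r by case: s; rewrite /part le_max lexx orbT.
have part_le s r : part s r <= `|r|.
  by case: s; rewrite /part ge_max normr_ge0 andbT ?ler_norm // -normrN ler_norm.
have mpart s : measurable_fun setT (part s).
  case: s; apply: measurable_maxr => //; exact: oppr_measurable.
have mgi i s : i \in I -> meas_wrt i (part s \o g i).
  move=> iI B mB; rewrite comp_preimage; apply: mg => //.
  by rewrite -[X in measurable X]setTI; exact: mpart.
pose m i s := fine (\int[P]_w (part s (g i w))%:E)%E.
have ipart i s : i \in I -> P.-integrable setT (EFin \o (part s \o g i)).
  move=> iI; apply: le_integrable (ig i iI) => //.
    exact/measurable_EFinP/(meas_wrt_measurable (mgi i s iI)).
  by move=> w _; rewrite /= lee_fin (ger0_norm (part0 _ _)).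
have mE i s : i \in I -> (\int[P]_w (part s (g i w))%:E = (m i s)%:E)%E.
  by move=> iI; rewrite fineK//; exact: integrable_fin_num (ipart i s iI).
have cE i : i \in I -> c i = \sum_(s : bool) sgn s * m i s.
  move=> iI; apply: EFin_inj; rewrite -gc// big_bool /= EFinD !EFinM -!mE//.
  rewrite -!integralZl//; [|exact: (ipart i false iI)|exact: (ipart i true iI)].
  rewrite -integralD//.
  - by apply: eq_integral => w _; rewrite [in LHS](partE (g i w)) big_bool.
  - by apply: integrableZl => //; exact: (ipart i true iI).
  - by apply: integrableZl => //; exact: (ipart i false iI).
have gE w : \prod_(i in I) g i w =
    \sum_(f in pffun_on false (mem I) (fun=> true))
      \prod_(i in I) (sgn (f i) * part (f i) (g i w)).
  by rewrite (eq_bigr _ (fun i _ => partE (g i w))) (big_distr_big false).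
rewrite (eq_bigr _ cE) (big_distr_big false) /=.
under eq_integral do rewrite gE -sumEFin.
have prodE (f : {ffun K -> bool}) :
    (\int[P]_w (\prod_(i in I) part (f i) (g i w))%:E = (\prod_(i in I) m i (f i))%:E)%E.
  apply: (@independent_ge0_integral_prod [set: K]%SET).
    by move=> i iI; rewrite finset.inE; split=> [|w]; [exact: mgi|exact: part0].
  by move=> i iI; exact: mE.
have prodI (f : {ffun K -> bool}) :
    P.-integrable setT (fun w => (\prod_(i in I) part (f i) (g i w))%:E).
  apply/integrableP; split.
    apply/measurable_EFinP; under eq_fun do rewrite -big_filter.
    apply: measurable_prod => i; rewrite mem_filter => /andP[iI _].
    exact: (meas_wrt_measurable (mgi i (f i) iI)).
  under eq_integral do rewrite gee0_abs ?lee_fin ?prodr_ge0//.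
  by rewrite prodE ltry.
rewrite integral_sum//; last first.
  move=> f; under eq_fun do rewrite big_split /= EFinM.
  by apply: integrableZl => //; exact: prodI.
rewrite -sumEFin; apply: eq_bigr => f _.
under eq_integral do rewrite big_split /= EFinM.
by rewrite integralZl// prodE -EFinM -big_split.
Qed.

End Independence.

Section SigmaGen.

Context d (T : measurableType d) (R : realType) (K : eqType) (C : set K) (X : K -> T -> R).

Let gen := \bigcup_(i in C) preimage_set_system setT (X i) measurable.

Lemma sigma_gen_measurable : (forall i, measurable_fun setT (X i)) ->
  forall A, sigma_gen C X A -> measurable A.
Proof.
move=> mX; apply: smallest_sub; first exact: sigma_algebra_measurable.
by move=> _ [i _ [B mB <-]]; exact: mX.
Qed.

(** With the generated sigma-algebra as the measurable structure of [T], the factors are measurable,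
    hence so is their finite product. *)
Lemma sigma_gen_prod (J : seq K) (B : set R) : (forall i, i \in J -> C i) ->
  measurable B -> sigma_gen C X ((fun w => \prod_(i <- J) X i w) @^-1` B).
Proof.
move=> JC mB.
have mXi i : i \in J -> measurable_fun (T := g_sigma_algebraType gen) setT (X i).
  move=> iJ _ D mD; apply: sub_sigma_algebra; exists i; first exact: JC.
  by exists D.
have := @measurable_prod _ (g_sigma_algebraType gen) R setT K J X mXi.
by move=> /(_ measurableT B mB); rewrite setTI.
Qed.

End SigmaGen.

(** If all factors are at most 1 in absolute value, so is the product; otherwise the k-th power of
    the largest one bounds it. Thus k-th moments alone make all partial products over a walk
    integrable. *)
Lemma norm_prod_le (R : realDomainType) (k : nat) (x : 'I_k -> R) (J : pred 'I_k) :
  `|\prod_(l | J l) x l| <= 1 + \sum_l `|x l| ^+ k.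
Proof.
have S0 : 0 <= \sum_l `|x l| ^+ k by apply: sumr_ge0 => l _; rewrite exprn_ge0.
rewrite normr_prod; have [small|] := boolP [forall l, `|x l| <= 1].
  apply: (@le_trans _ _ 1); last by rewrite lerDl.
  apply: (@le_trans _ _ (\prod_(l | J l) 1)); last by rewrite big1.
  by apply: ler_prod => l _; rewrite normr_ge0 (forallP small).
case/forallPn=> l0 _; case: (@arg_maxP _ _ _ l0 xpredT (fun l => `|x l|) isT) => l1 _ max1.
have [le1|lt1] := leP `|x l1| 1.
  apply: (@le_trans _ _ 1); last by rewrite lerDl.
  apply: (@le_trans _ _ (\prod_(l | J l) 1)); last by rewrite big1.
  by apply: ler_prod => l _; rewrite normr_ge0 (le_trans (max1 l isT)).
apply: (@le_trans _ _ (`|x l1| ^+ k)); last first.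
  by rewrite (bigD1 l1)//= addrCA lerDl addr_ge0// sumr_ge0// => l _; exact: exprn_ge0.
apply: (@le_trans _ _ (\prod_(l | J l) `|x l1|)).
  by apply: ler_prod => l _; rewrite normr_ge0; exact: max1.
rewrite prodr_const ler_eXn2l ?ltW//; first by rewrite -[X in (_ <= X)%N]card_ord max_card.
Qed.

(** * Traces of powers as sums over closed walks *)

Section TraceWalks.

Variables (R : comPzRingType) (n : nat) (A : 'M[R]_n).

Lemma mx_exp_walks m i j :
  (A ^+ m.+1) i j = \sum_(ys : m.-tuple 'I_n) \prod_(u <- steps i ys j) A u.1 u.2.
Proof.
elim: m i j => [|m IH] i j.
  by rewrite expr1 big_tuple0 /= big_seq1.
rewrite exprS mxE big_tupleS; apply: eq_bigr => y _; rewrite IH mulr_sumr.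
by apply: eq_bigr => ys _ /=; rewrite big_cons.
Qed.

Lemma trace_walks k' :
  \tr (A ^+ k'.+1) = \sum_(x : k'.+1.-tuple 'I_n) \prod_l A (edge x l).1 (edge x l).2.
Proof.
rewrite /mxtrace big_tupleS; apply: eq_bigr => i _; rewrite mx_exp_walks.
apply: eq_bigr => ys _; set x := [tuple of i :: ys].
rewrite (big_nth (i, i)) big_mkord size_steps size_tuple.
by apply: eq_bigr => l _; rewrite -(edge_steps (i, i) x l).
Qed.

End TraceWalks.

(** * Expected products along a walk *)

Section WalkMoments.

Context d (T : measurableType d) (R : realType) (P : probability T R).
Variables (n k' : nat) (e : rel ('I_n * 'I_n)) (X : 'I_n -> 'I_n -> T -> R).
Notation k := k'.+1.
Notation walk := (k.-tuple 'I_n).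
Hypothesis e_equiv : equivalence_rel e.
Hypothesis X_meas : forall i j, measurable_fun setT (X i j).
Hypothesis X_sym : forall i j, X i j = X j i.
Hypothesis X_mean : forall i j, (\int[P]_w (X i j w)%:E = 0)%E.
Hypothesis X_var : forall i j, (\int[P]_w ((X i j w) ^+ 2)%:E = 1)%E.
Variable M : R.
Hypothesis X_moment : forall i j, (\int[P]_w (`|X i j w| ^+ k)%:E <= M%:E)%E.
Hypothesis X_indep : mutually_independent P (eq_classes e)
  (fun C => sigma_gen [set pq | pq \in C] (fun pq : 'I_n * 'I_n => X pq.1 pq.2)).

Let Xe (u : 'I_n * 'I_n) := X u.1 u.2.

Definition walk_moment (x : walk) : R := fine (\int[P]_w (\prod_l Xe (edge x l) w)%:E)%E.

Let integral_one : (\int[P]_w (cst 1%E w) = 1)%E.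
Proof. by rewrite integral_cst// mul1e; exact: probability_setT. Qed.

Let measurable_walk (x : walk) (J : pred 'I_k) :
  measurable_fun setT (fun w => \prod_(l | J l) Xe (edge x l) w).
Proof.
under eq_fun do rewrite -big_filter.
by apply: measurable_prod => l _; exact: X_meas.
Qed.

Let measurable_dom (x : walk) l : measurable_fun setT (fun w => `|Xe (edge x l) w| ^+ k).
Proof.
by apply: measurable_funX; apply: measurableT_comp => //; exact: X_meas.
Qed.

Let integrable_dom (x : walk) l : P.-integrable setT (fun w => (`|Xe (edge x l) w| ^+ k)%:E).
Proof.
apply/integrableP; split; first exact/measurable_EFinP.
under eq_integral do rewrite gee0_abs ?lee_fin ?exprn_ge0//.
by apply: le_lt_trans (X_moment _ _) _; rewrite ltry.
Qed.

Let integrable_bound (x : walk) :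
  P.-integrable setT (fun w => (1 + \sum_l `|Xe (edge x l) w| ^+ k)%:E).
Proof.
pose h (w : T) : \bar R := (\sum_(l < k) (`|Xe (edge x l) w| ^+ k)%:E)%E.
rewrite (_ : (fun w => _) = ((EFin \o cst 1%R) \+ h)%E); last first.
  by apply/funext => w; rewrite /h /= EFinD sumEFin.
apply: integrableD => //; first exact: finite_measure_integrable_cst.
exact: integrable_sum.
Qed.

Lemma integrable_walk (x : walk) (J : pred 'I_k) :
  P.-integrable setT (fun w => (\prod_(l | J l) Xe (edge x l) w)%:E).
Proof.
apply: le_integrable (integrable_bound x) => //.
  exact/measurable_EFinP.
move=> w _; rewrite /= lee_fin; apply: le_trans (norm_prod_le _ _) _.
by rewrite ler_norm.
Qed.

Lemma integral_walk (x : walk) :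
  (\int[P]_w (\prod_l Xe (edge x l) w)%:E = (walk_moment x)%:E)%E.
Proof. by rewrite fineK//; apply: integrable_fin_num => //; exact: integrable_walk. Qed.

Lemma walk_moment_le (x : walk) : `|walk_moment x| <= 1 + k%:R * M.
Proof.
rewrite -lee_fin -[X in (X <= _)%E]abse_EFin -integral_walk.
apply: le_trans (le_abse_integral _ _ _) _ => //; first exact/measurable_EFinP.
apply: (@le_trans _ _ (\int[P]_w (1 + \sum_l `|Xe (edge x l) w| ^+ k)%:E)%E).
  apply: ge0_le_integral => //.
  - by apply: measurableT_comp => //; exact/measurable_EFinP.
  - by have /integrableP[] := integrable_bound x.
  - by move=> w _; rewrite lee_fin norm_prod_le.
under eq_integral do rewrite EFinD -sumEFin.
rewrite integralD//; last 2 first.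
- exact: finite_measure_integrable_cst.
- exact: integrable_sum.
rewrite integral_one EFinD leeD2l//.
rewrite integral_sum//; apply: (@le_trans _ _ (\sum_(l < k) M%:E)%E).
  by apply: lee_sum => l _; exact: X_moment.
by rewrite sumEFin sumr_const card_ord mulr_natl.
Qed.

Let class (u : 'I_n * 'I_n) := [set v | e u v]%SET.

Let class_in u : class u \in eq_classes e.
Proof. by apply/imsetP; exists u => //; apply/setP => v; rewrite !finset.inE. Qed.

Let in_class C u : C \in eq_classes e -> (u \in C) = (class u == C).
Proof.
move=> /imsetP[v _ ->]; apply/idP/eqP => [|<-]; rewrite !finset.inE /=.
  move=> vu; apply/setP => z; rewrite !finset.inE.
  by have [_ /(_ vu) ->] := e_equiv v u z.
by rewrite (equivalence_refl e_equiv).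
Qed.

Let factor (x : walk) (C : {set 'I_n * 'I_n}) (w : T) :=
  \prod_(l | edge x l \in C) Xe (edge x l) w.

(** Edges are grouped by their class, and different classes are independent; a class that the walk
    misses contributes the empty product. *)
Lemma walk_moment_factor (x : walk) :
  walk_moment x = \prod_(C in eq_classes e) fine (\int[P]_w (factor x C w)%:E)%E.
Proof.
apply: EFin_inj; rewrite -integral_walk.
have E w : \prod_l Xe (edge x l) w = \prod_(C in eq_classes e) factor x C w.
  rewrite (partition_big (fun l => class (edge x l)) (mem (eq_classes e))) /=; last first.
    by move=> l _; exact: class_in.
  by apply: eq_bigr => C CE; apply: eq_bigl => l; rewrite in_class.
under eq_integral do rewrite E.
apply: (independent_integral_prod X_indep) => //.
- by move=> C A; apply: sigma_gen_measurable => u; exact: X_meas.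
- move=> C CE B mB; rewrite /factor.
  have -> : (fun w => \prod_(l | edge x l \in C) Xe (edge x l) w) =
      (fun w => \prod_(u <- [seq edge x l | l <- enum 'I_k & edge x l \in C]) Xe u w).
    apply/funext => w; rewrite big_map big_filter; apply: esym.
    by rewrite big_enum_cond.
  apply: sigma_gen_prod => // u /mapP[l]; rewrite mem_filter => /andP[lC _] ->.
  exact: lC.
- by move=> C CE; exact: integrable_walk.
- move=> C CE; rewrite fineK//; apply: integrable_fin_num => //; exact: integrable_walk.
Qed.

(** The factor of that class is a single centred entry. *)
Lemma walk_moment_single (x : walk) l : #|block e x l| = 1%N -> walk_moment x = 0.
Proof.
move=> l1; rewrite walk_moment_factor (bigD1 (class (edge x l))) ?class_in//=.
have -> : factor x (class (edge x l)) = Xe (edge x l).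
  apply/funext => w; rewrite /factor (big_pred1 l)// => m /=.
  have /cards1P[m0 bE] : #|block e x l| == 1%N by rewrite l1.
  have := mem_block e_equiv x l; rewrite bE finset.inE => /eqP lE.
  have : (m \in block e x l) = (m == l) by rewrite bE finset.inE -lE.
  by rewrite !finset.inE.
by rewrite X_mean /= mul0r.
Qed.

(** In a tree walk the two edges of a class are equal or reversed, so by symmetry of the matrix each
    factor is the second moment of one entry. *)
Lemma walk_moment_tree b (x : walk) : (forall p q, e (p, q) (q, p)) ->
  x \in tree_walks k' b e -> walk_moment x = 1.
Proof.
move=> e_swap /(tree_walksP e_equiv e_swap)[px sym].
rewrite walk_moment_factor big1// => C CE.
have [l lC|noC] := pickP [pred l | edge x l \in C]; last first.
  rewrite (_ : (fun w => _) = cst 1%E); first by rewrite [X in fine X]integral_one.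
  by apply/funext => w; rewrite /factor big_pred0.
have CEl : C = class (edge x l) by apply/esym/eqP; rewrite -in_class.
rewrite (_ : (fun w => (factor x C w)%:E) = (fun w => ((Xe (edge x l) w) ^+ 2)%:E)).
  by rewrite X_var.
apply/funext => w; rewrite /factor.
rewrite (eq_bigl (mem (block e x l))); last by move=> m; rewrite CEl !finset.inE.
rewrite (eq_bigr (fun=> Xe (edge x l) w)); last first.
  move=> m; rewrite !finset.inE => /sym[->//|->].
  by rewrite /Xe /= X_sym.
by rewrite prodr_const (eqP (forallP px l)).
Qed.

Lemma integral_trace (b : nat) (A : T -> 'M[R]_n) (s : R) :
  (forall w i j, A w i j = s * ((if in_band b i j then 1 else 0) * X i j w)) ->
  (\int[P]_w (\tr (A w ^+ k))%:E =
    (s ^+ k * \sum_(x : walk | banded b x) walk_moment x)%:E)%E.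
Proof.
move=> AE.
have prodE w (x : walk) : \prod_l A w (edge x l).1 (edge x l).2 =
    s ^+ k * ((if banded b x then 1 else 0) * \prod_l Xe (edge x l) w).
  under eq_bigr do rewrite AE.
  rewrite !big_split /= prodr_const card_ord; congr (_ * (_ * _)).
  have [bx|] := boolP (banded b x); first by rewrite big1// => l _; rewrite (forallP bx).
  by case/forallPn=> l nl; rewrite (bigD1 l)//= (negbTE nl) mul0r.
under eq_integral do rewrite trace_walks -sumEFin.
have int_x (x : walk) : P.-integrable setT (fun w => (\prod_l A w (edge x l).1 (edge x l).2)%:E).
  rewrite (_ : (fun w => _) = (fun w => (s ^+ k * (if banded b x then 1 else 0))%:E *
      (\prod_l Xe (edge x l) w)%:E)%E); first by apply: integrableZl => //; exact: integrable_walk.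
  by apply/funext => w; rewrite prodE mulrA EFinM.
rewrite integral_sum// mulr_sumr [in RHS]big_mkcond -sumEFin; apply: eq_bigr => x _.
under eq_integral do rewrite prodE mulrA EFinM.
rewrite integralZl//; last exact: integrable_walk.
by rewrite integral_walk -EFinM; case: ifP; rewrite ?mulr1// mulr0 mul0r.
Qed.

End WalkMoments.

(** * The limit *)

Section Estimate.

Variables (R : realType) (n b B k' : nat) (e : rel ('I_n * 'I_n)).
Notation k := k'.+1.
Notation walk := (k.-tuple 'I_n).
Notation a := (2 * b).+1.
Hypothesis n_gt0 : (0 < n)%N.
Hypothesis b_gt0 : (0 < b)%N.
Hypothesis B_gt0 : (0 < B)%N.
Hypothesis e_equiv : equivalence_rel e.
Hypothesis e_swap : forall p q, e (p, q) (q, p).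
Hypothesis eB : forall p q r : 'I_n, (#|[set s : 'I_n | e (p, q) (r, s)]%SET| <= B)%N.
Variables (mom : walk -> R) (D : R).
Hypothesis mom_le : forall x, `|mom x| <= D.
Hypothesis mom_single : forall x l, #|block e x l| = 1%N -> mom x = 0.
Hypothesis mom_tree : forall x, x \in tree_walks k' b e -> mom x = 1.

Let few := [set x : walk | banded b x && (2 * #|blocks e x| < k)%N]%SET.
Let crossed := [set x : walk | [&& banded b x, pairing e x & crossing e x]]%SET.
Let skew := [set x : walk | [&& banded b x, pairing e x & skewed e x]]%SET.
Let tree := tree_walks k' b e.

(** By [walk_cases] a banded walk outside the tree walks lies in one of the three exceptional sets,
    unless a singleton class makes its moment vanish. *)
Lemma moment_sum_tree :
  `|\sum_(x : walk | banded b x) mom x - #|tree|%:R|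
    <= D * (#|few|%:R + #|crossed|%:R + #|skew|%:R).
Proof.
have treeE : #|tree|%:R = \sum_(x in tree) mom x :> R.
  by rewrite -sum1_card natr_sum; apply: eq_bigr => x /mom_tree ->.
rewrite treeE (bigID (mem tree)) /= (eq_bigl (mem tree)); last first.
  by move=> x; rewrite /= andb_idl// finset.inE => /and3P[].
rewrite addrAC subrr add0r.
apply: le_trans (ler_norm_sum _ _ _) _.
apply: (@le_trans _ _ (\sum_(x in (few :|: crossed :|: skew)%SET) D)).
  rewrite [leLHS](bigID (mem (few :|: crossed :|: skew)%SET)) /=.
  rewrite [X in _ + X]big1 ?addr0; last first.
    move=> x /andP[/andP[bx xt] xU].
    have [/forallP sz2|] := boolP [forall l, (1 < #|block e x l|)%N].
      have := walk_cases e_equiv bx sz2; rewrite (negbTE xt) orbF.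
      by move: xU; rewrite !finset.inE bx /= -orbA => /negbTE ->.
    case/forallPn=> l; rewrite -leqNgt => l1; rewrite (mom_single (l := l)) ?normr0//.
    apply/eqP; rewrite eqn_leq l1 /= card_gt0; apply/finset.set0Pn; exists l.
    exact: mem_block.
  rewrite [leLHS]big_mkcond [leRHS]big_mkcond; apply: ler_sum => x _.
  case: ifP => [/andP[_ ->]//|_]; case: ifP => // _.
  exact: le_trans (mom_le x).
rewrite sumr_const -[leLHS]mulr_natr ler_wpM2l//.
  by rewrite (le_trans _ (mom_le [tuple of nseq k (Ordinal n_gt0)])).
rewrite -!natrD ler_nat (leq_trans (leq_card_setU _ _))// leq_add2r.
exact: leq_card_setU.
Qed.

Let s : R := (Num.sqrt (2 * b%:R))^-1.
Let qi : R := (2 * b%:R)^-1.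

Let b0 : 0 < b%:R :> R. Proof. by rewrite ltr0n. Qed.
Let n0 : 0 < n%:R :> R. Proof. by rewrite ltr0n. Qed.
Let b1 : 1 <= b%:R :> R. Proof. by rewrite ler1n. Qed.
Let q0 : 0 < 2 * b%:R :> R. Proof. by rewrite mulr_gt0. Qed.

Let s2 : s ^+ 2 = qi.
Proof. by rewrite exprVn sqr_sqrtr// ltW. Qed.

Let s0 : 0 <= s. Proof. by rewrite invr_ge0 sqrtr_ge0. Qed.

Let qi0 : 0 <= qi. Proof. by rewrite invr_ge0 ltW. Qed.

Let qi1 : qi <= 1.
Proof. by rewrite invf_le1// -[leLHS]mulr1 ler_pM// ler1n. Qed.

Let s1 : s <= 1.
Proof. by rewrite -(@expr_le1 _ 2%N)// s2. Qed.

Let aE : qi * a%:R = 1 + qi.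
Proof. by rewrite -natr1 natrM mulrDr mulr1 mulVf// gt_eqF. Qed.

(** Each factor [a] is matched with s^2 = 1/(2b), which leaves 1 + 1/(2b); unmatched powers of [s]
    remain. *)
Let expr_scaled j : (2 * j <= k)%N -> s ^+ k * a%:R ^+ j = (1 + qi) ^+ j * s ^+ (k - 2 * j).
Proof.
move=> jk; rewrite -aE exprMn -s2 -exprM -[in LHS](subnKC jk) exprD.
exact: mulrAC.
Qed.

Let pow2 j : (j <= k)%N -> (1 + qi) ^+ j <= 2 ^+ k.
Proof.
move=> jk; apply: (@le_trans _ _ (2 ^+ j)); last by rewrite ler_eXn2l// ltr1n.
rewrite lerXn2r ?nnegrE ?addr_ge0//.
by rewrite -[leRHS]/(1 + 1) lerD2l.
Qed.

Let half_le : (2 * k./2 <= k)%N. Proof. by clear; lia. Qed.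
Let half_le1 : (k./2 <= k)%N. Proof. by clear; lia. Qed.
Let half_pred : (2 * k'./2 <= k)%N. Proof. by clear; lia. Qed.
Let half_pred1 : (k'./2 <= k)%N. Proof. by clear; lia. Qed.
Let half_pred2 : (0 < k - 2 * k'./2)%N. Proof. by clear; lia. Qed.
Let B_pow : (B ^ k <= B ^ (2 * k))%N.
Proof. by rewrite leq_pexp2l// leq_pmull. Qed.
Let b_le_a : b%:R <= a%:R :> R. Proof. by rewrite ler_nat; clear; lia. Qed.

Let scaled_le : s ^+ k * a%:R ^+ k./2 <= 2 ^+ k.
Proof.
rewrite expr_scaled// -[leRHS]mulr1 ler_pM ?exprn_ge0 ?addr_ge0//.
  exact: pow2.
by rewrite exprn_ile1.
Qed.

(** One constant for all exceptional sets, depending on k and [B] only; [2 ^+ k] bounds the powers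
    of 1 + 1/(2b). *)
Definition estimate_const : R := (pattern_count k * B ^ (2 * k))%:R * 2 ^+ k.

Let C0 := estimate_const.
Let C00 : 0 <= C0. Proof. by rewrite mulr_ge0// exprn_ge0. Qed.
Let weight : R := n%:R^-1 * s ^+ k.
Let weight0 : 0 <= weight. Proof. by rewrite mulr_ge0// ?invr_ge0 ?exprn_ge0// ltW. Qed.

(** At most [k'./2] factors [a] leave at least one power of [s] unmatched. *)
Lemma few_estimate : weight * #|few|%:R <= C0 * s.
Proof.
have H := card_few_blocks b B_gt0 e_equiv e_swap eB (ltn0Sn k').
apply: (@le_trans _ _ (weight * (pattern_count k * (n * B ^ k * a ^ k'./2))%:R)).
  by rewrite ler_wpM2l// ler_nat.
have -> : weight * (pattern_count k * (n * B ^ k * a ^ k'./2))%:R =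
    (pattern_count k * B ^ k)%:R * (s ^+ k * a%:R ^+ k'./2).
  rewrite /weight !natrM !natrX; field; exact: lt0r_neq0.
rewrite expr_scaled//.
rewrite -[leRHS]mulrA ler_pM//; first by rewrite mulr_ge0// exprn_ge0// addr_ge0.
  by rewrite ler_nat leq_mul2l B_pow orbT.
rewrite ler_pM ?exprn_ge0 ?addr_ge0//; first exact: pow2.
by rewrite -[leRHS]expr1 ler_wiXn2l.
Qed.

(** (O1) puts [M1] in place of [a ^ 2], and a >= b. *)
Lemma crossing_estimate M1 :
  (forall p : 'I_n, (#|[set t : 'I_n * 'I_n * 'I_n | e (p, t.1.1) (t.1.2, t.2)]%SET| <= M1)%N) ->
  weight * #|crossed|%:R <= C0 * (M1%:R / b%:R ^+ 2).
Proof.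
move=> HM; have H := card_crossing_walks k b B_gt0 e_equiv e_swap eB HM.
have a0 : 0 < a%:R :> R by rewrite ltr0n.
apply: (@le_trans _ _ (weight * (pattern_count k * (n * M1 * B ^ (2 * k) * a ^ k./2))%:R / a%:R ^+ 2)).
  rewrite ler_pdivlMr ?exprn_gt0// -mulrA ler_wpM2l// -natrX -natrM ler_nat; exact: H.
have -> : weight * (pattern_count k * (n * M1 * B ^ (2 * k) * a ^ k./2))%:R / a%:R ^+ 2 =
    (pattern_count k * B ^ (2 * k))%:R * (s ^+ k * a%:R ^+ k./2) * (M1%:R / a%:R ^+ 2).
  rewrite /weight !natrM !natrX; field; rewrite !lt0r_neq0//.
apply: ler_pM.
- by rewrite ?mulr_ge0 ?exprn_ge0.
- by rewrite ?mulr_ge0 ?invr_ge0 ?exprn_ge0.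
- by rewrite ler_wpM2l.
rewrite ler_wpM2l// lef_pV2 ?posrE ?exprn_gt0// lerXn2r ?nnegrE// ltW.
Qed.

(** (O3) puts [M3] in place of [n * a], and M3 / (n b) = (M3 / b^2) (b / n). *)
Lemma skewed_estimate M3 :
  (#|[set t : 'I_n * 'I_n * 'I_n | e (t.1.1, t.1.2) (t.1.2, t.2) && (t.2 != t.1.1)]%SET| <= M3)%N ->
  weight * #|skew|%:R <= C0 * (M3%:R / b%:R ^+ 2 * (b%:R / n%:R)).
Proof.
move=> HM; have H := card_skewed_walks k b B_gt0 e_equiv e_swap eB.
have a0 : 0 < a%:R :> R by rewrite ltr0n.
apply: (@le_trans _ _ (weight * (pattern_count k * (M3 * B ^ k * a ^ k./2))%:R / a%:R)).
  rewrite ler_pdivlMr// -mulrA ler_wpM2l// -natrM ler_nat; apply: leq_trans H _.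
  by rewrite leq_mul2l !leq_mul2r HM !orbT.
have -> : weight * (pattern_count k * (M3 * B ^ k * a ^ k./2))%:R / a%:R =
    (pattern_count k * B ^ k)%:R * (s ^+ k * a%:R ^+ k./2) * (M3%:R / a%:R / n%:R).
  rewrite /weight !natrM !natrX; field; rewrite !lt0r_neq0//.
apply: ler_pM.
- by rewrite ?mulr_ge0 ?exprn_ge0.
- by rewrite ?mulr_ge0 ?invr_ge0.
- apply: ler_pM => //; first by rewrite mulr_ge0 ?exprn_ge0.
  by rewrite ler_nat leq_mul2l B_pow orbT.
have -> : M3%:R / b%:R ^+ 2 * (b%:R / n%:R) = M3%:R / b%:R / n%:R :> R.
  by field; rewrite !lt0r_neq0.
by rewrite ler_wpM2r ?invr_ge0 ?(ltW n0)// ler_wpM2l// lef_pV2 ?posrE.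
Qed.

Let Cat : R := (ballot k 0)%:R.

(** The upper count gives the main term exactly. The lower count loses the walks with few classes
    and, through the ends of the index range, a share 2kb/n. *)
Lemma tree_estimate :
  `|weight * #|tree|%:R - Cat * (1 + qi) ^+ k./2|
    <= 2 ^+ k * (C0 * s) + 2 * k%:R * Cat * 2 ^+ k * (b%:R / n%:R).
Proof.
have up := card_tree_walks_le k' b e; have lo := card_tree_walks_ge k' b e_equiv e_swap.
have few0 := few_estimate.
have bn0 : 0 <= b%:R / n%:R :> R by rewrite divr_ge0.
have Cat0 : 0 <= Cat by [].
have err0 : 0 <= 2 * k%:R * Cat * 2 ^+ k * (b%:R / n%:R).
  by rewrite !mulr_ge0// exprn_ge0.
have few1 : 0 <= 2 ^+ k * (C0 * s) by rewrite !mulr_ge0// exprn_ge0.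
(* For odd k there are no tree walks and [Cat] is 0. *)
have [ko|ke] := boolP (odd k).
  have Cz : Cat = 0 by rewrite /Cat ballot_odd// addn0.
  have -> : #|tree| = 0%N.
    apply/eqP; rewrite -leqn0; apply: leq_trans up _.
    by rewrite ballot_odd ?addn0// mul0n muln0.
  by rewrite Cz mulr0 mul0r subrr normr0 addr_ge0// -Cz.
have kE : s ^+ k * a%:R ^+ k./2 = (1 + qi) ^+ k./2.
  rewrite expr_scaled// (_ : (k - 2 * k./2 = 0)%N) ?expr0 ?mulr1//.
  by move: ke; clear; lia.
have pw : (1 + qi) ^+ k./2 <= 2 ^+ k by exact: pow2.
rewrite ler_norml; apply/andP; split; last first.
  rewrite lerBlDr; apply: (@le_trans _ _ (Cat * (1 + qi) ^+ k./2)); last by rewrite lerDr addr_ge0.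
  apply: (@le_trans _ _ (weight * (n * (ballot k 0 * a ^ k./2))%:R)).
    by rewrite ler_wpM2l// ler_nat.
  rewrite -kE !natrM natrX /weight /Cat le_eqVlt; apply/orP; left; apply/eqP.
  by field; exact: lt0r_neq0.
rewrite lerBrDr addrC lerBlDr.
have lo' : (n%:R - 2 * k%:R * b%:R) * (Cat * a%:R ^+ k./2) <= #|tree|%:R + #|few|%:R * 2 ^+ k :> R.
  apply: (@le_trans _ _ (((n - 2 * k * b) * (ballot k 0 * a ^ k./2))%:R : R)).
    rewrite [leRHS]natrM (natrM _ (ballot k 0)) natrX ler_wpM2r ?mulr_ge0 ?exprn_ge0//.
    have [nk|nk] := leqP (2 * k * b) n.
      by rewrite natrB// !natrM.
    apply: (@le_trans _ _ 0) => //; rewrite subr_le0 -!natrM ler_nat; exact: ltnW.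
  by rewrite -natrX -natrM -natrD ler_nat.
have := ler_wpM2l weight0 lo'; rewrite mulrDr.
have -> : weight * ((n%:R - 2 * k%:R * b%:R) * (Cat * a%:R ^+ k./2)) =
    Cat * (1 + qi) ^+ k./2 - 2 * k%:R * Cat * (1 + qi) ^+ k./2 * (b%:R / n%:R).
  by rewrite -kE /weight; field; exact: lt0r_neq0.
have few2 : weight * (#|few|%:R * 2 ^+ k) <= 2 ^+ k * (C0 * s).
  by rewrite mulrA [leLHS]mulrC ler_wpM2l// exprn_ge0.
have cat2 : 2 * k%:R * Cat * (1 + qi) ^+ k./2 * (b%:R / n%:R) <=
    2 * k%:R * Cat * 2 ^+ k * (b%:R / n%:R).
  by rewrite ler_wpM2r// ler_wpM2l// !mulr_ge0.
lra.
Qed.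

(** Walks with few classes enter twice, with weight [D] for their own moments and with weight
    [2 ^+ k] for the lower count of tree walks. *)
Lemma moment_estimate M1 M3 :
  (forall p : 'I_n, (#|[set t : 'I_n * 'I_n * 'I_n | e (p, t.1.1) (t.1.2, t.2)]%SET| <= M1)%N) ->
  (#|[set t : 'I_n * 'I_n * 'I_n | e (t.1.1, t.1.2) (t.1.2, t.2) && (t.2 != t.1.1)]%SET| <= M3)%N ->
  `|n%:R^-1 * (s ^+ k * \sum_(x : walk | banded b x) mom x) - Cat * (1 + qi) ^+ k./2| <=
    (D + 2 ^+ k) * C0 * s + D * C0 * (M1%:R / b%:R ^+ 2)
    + D * C0 * (M3%:R / b%:R ^+ 2 * (b%:R / n%:R))
    + 2 * k%:R * Cat * 2 ^+ k * (b%:R / n%:R).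
Proof.
move=> H1 H3.
have D0 : 0 <= D by rewrite (le_trans _ (mom_le [tuple of nseq k (Ordinal n_gt0)])).
have h1 := ler_wpM2l D0 few_estimate; have h2 := ler_wpM2l D0 (crossing_estimate H1).
have h3 := ler_wpM2l D0 (skewed_estimate H3); have h4 := tree_estimate.
have h5 := ler_wpM2l weight0 moment_sum_tree.
have splitE (S t c : R) :
    n%:R^-1 * (s ^+ k * S) - c = weight * (S - t) + (weight * t - c).
  by rewrite /weight; ring.
rewrite (splitE _ #|tree|%:R).
apply: le_trans (ler_normD _ _) _; rewrite normrM (ger0_norm weight0).
have := lerD h5 h4; move/le_trans; apply; lra.
Qed.

End Estimate.

(** * Convergence of the error terms *)

Lemma littleo_seq_cvg (R : realType) (u v : nat -> R) :
  littleo_seq u v -> (fun N => u N / v N) @ \oo --> (0 : R).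
Proof.
move=> uv; apply/cvgr0Pnorm_le => eps eps0; near=> N.
have uvN : `|u N| <= eps * `|v N| by near: N; exact: uv.
(* Where [v N] is 0 the quotient is 0 too, as the inverse of 0 is 0. *)
rewrite normrM normfV; have [->|v0] := eqVneq (v N) 0.
  by rewrite normr0 invr0 mulr0 ltW.
by rewrite ler_pdivrMr// normr_gt0.
Unshelve. all: end_near.
Qed.

Lemma cvg_inv_double (R : realType) (b : nat -> nat) :
  b @ \oo --> \oo -> (fun N => (2 * (b N)%:R)^-1 : R) @ \oo --> (0 : R).
Proof.
move=> b_infty.
have inv0 : (fun m : nat => (m%:R)^-1 : R) @ \oo --> (0 : R).
  apply/gtr0_cvgV0; last exact: cvgr_idn.
  by near=> m; rewrite ltr0n; near: m; exact: nbhs_infty_gt.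
rewrite (_ : (fun N => _) = (fun N => 2^-1 * (b N)%:R^-1)); last first.
  by apply/funext => N; rewrite invfM.
rewrite -[X in _ --> X](mulr0 2^-1); apply: cvgM; first exact: cvg_cst.
exact: cvg_comp b_infty inv0.
Unshelve. all: end_near.
Qed.

Lemma semicircle_ballot (R : realType) k : semicircle_moment R k = (ballot k 0)%:R.
Proof.
rewrite /semicircle_moment; case: ifP => [ko|/negbT ke].
  by rewrite ballot_odd// addn0.
have kE : k = (2 * k./2)%N by move: ke; clear; lia.
have E := ballot_catalan k./2; rewrite -kE in E.
by rewrite -E natrM mulrAC mulfV ?mul1r//.
Qed.

Theorem mainTheorem14
  (R : realType) (b : nat -> nat)
  (rel_ : forall N : nat, rel ('I_N * 'I_N))
  (d : measure_display) (T : nat -> measurableType d)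
  (P : forall N : nat, probability (T N) R)
  (X : forall N : nat, 'I_N -> 'I_N -> T N -> R)
  (* the band widths *)
  (b_pos : forall N, (0 < b N)%N)
  (b_infty : (fun N => (b N : nat)) @ \oo --> \oo)
  (b_o : littleo_seq (fun N => (b N)%:R : R) (fun N => N%:R))
  (* the equivalence relation *)
  (rel_equiv : forall N, equivalence_rel (rel_ N))
  (rel_swap : forall N (p q : 'I_N), rel_ N (p, q) (q, p))
  (O1 : littleo_seq
     (fun N => (\max_(p : 'I_N)
        #|[set t : 'I_N * 'I_N * 'I_N | rel_ N (p, t.1.1) (t.1.2, t.2)]%SET|)%:R : R)
     (fun N => ((b N)%:R : R) ^+ 2))
  (O2 : exists B : nat, forall N (p q r : 'I_N),
     (#|[set s : 'I_N | rel_ N (p, q) (r, s)]%SET| <= B)%N)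
  (O3 : littleo_seq
     (fun N => (#|[set t : 'I_N * 'I_N * 'I_N |
        rel_ N (t.1.1, t.1.2) (t.1.2, t.2) && (t.2 != t.1.1)]%SET|)%:R : R)
     (fun N => ((b N)%:R : R) ^+ 2))
  (* the random variables *)
  (X_meas : forall N (i j : 'I_N), measurable_fun setT (X N i j))
  (X_sym : forall N (i j : 'I_N), X N i j = X N j i)
  (X_mean : forall N (i j : 'I_N), (\int[P N]_w (X N i j w)%:E = 0)%E)
  (X_var : forall N (i j : 'I_N), (\int[P N]_w ((X N i j w) ^+ 2)%:E = 1)%E)
  (X_moments : forall k : nat, exists M : R, forall N (i j : 'I_N),
     (\int[P N]_w (`|X N i j w| ^+ k)%:E <= M%:E)%E)
  (X_indep : forall N, mutually_independent (P N) (eq_classes (rel_ N))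
     (fun C => sigma_gen (R := R) [set pq | pq \in C]%classic
                 (fun pq : 'I_N * 'I_N => X N pq.1 pq.2))) :
  forall k : nat,
    (fun N => ((N%:R)^-1)%:E *
       \int[P N]_w (\tr (band_matrix (b N) (fun i j => X N i j w) ^+ k))%:E)%E
      @ \oo --> ((semicircle_moment R k)%:E).
Proof.
(* For k = 0 the trace is N, and the normalised value is 1 as soon as N > 0. *)
case=> [|k'].
  have sc0 : semicircle_moment R 0 = 1 by rewrite /semicircle_moment /= bin0 divr1.
  rewrite sc0; apply: cvg_near_cst; near=> N.
  have N0 : (0 < N)%N by near: N; exact: nbhs_infty_gt.
  have -> : (\int[P N]_w (\tr (band_matrix (b N) (fun i j => X N i j w) ^+ 0))%:E = N%:R%:E)%E.
    rewrite (eq_integral (cst N%:R%:E)); last by move=> w _; rewrite expr0 mxtrace1.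
    rewrite integral_cst// -[RHS]mule1; congr (_ * _)%E; exact: probability_setT.
  by rewrite -EFinM mulVf// pnatr_eq0 -lt0n.
set k := k'.+1.
(* The successor makes the bound of (O2) positive, so that its powers increase. *)
have [B0 eB0] := O2; pose B := B0.+1.
have eB N (p q r : 'I_N) : (#|[set s : 'I_N | rel_ N (p, q) (r, s)]%SET| <= B)%N.
  exact: leq_trans (eB0 N p q r) (leqnSn _).
have [M XM] := X_moments k; pose D := 1 + k%:R * `|M|.
pose mom N (x : k.-tuple 'I_N) := walk_moment (P N) (X N) x.
pose s N : R := (Num.sqrt (2 * (b N)%:R))^-1.
pose r N : R := N%:R^-1 * (s N ^+ k * \sum_(x : k.-tuple 'I_N | banded (b N) x) mom N x).
have -> : (fun N => ((N%:R)^-1)%:E *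
    \int[P N]_w (\tr (band_matrix (b N) (fun i j => X N i j w) ^+ k))%:E)%E = EFin \o r.
  apply/funext => N /=; rewrite (integral_trace (X_meas N) (XM N) (b := b N) (s := s N)) -?EFinM//.
  move=> w i j; rewrite mxE.
  have -> // : (`|(i : nat) - (j : nat)| <= b N)%N = in_band (b N) i j.
  by rewrite /in_band; clear; lia.
apply: cvg_EFin; first by near=> N.
rewrite semicircle_ballot.
pose q N : R := (2 * (b N)%:R)^-1.
pose M1 N := (\max_(p : 'I_N)
  #|[set t : 'I_N * 'I_N * 'I_N | rel_ N (p, t.1.1) (t.1.2, t.2)]%SET|)%N.
pose M3 N := #|[set t : 'I_N * 'I_N * 'I_N |
  rel_ N (t.1.1, t.1.2) (t.1.2, t.2) && (t.2 != t.1.1)]%SET|.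
pose x1 N : R := (M1 N)%:R / (b N)%:R ^+ 2.
pose x3 N : R := (M3 N)%:R / (b N)%:R ^+ 2.
pose v N : R := (b N)%:R / N%:R.
pose C0 := estimate_const R B k'.
pose Cat : R := (ballot k 0)%:R.
(* Every summand has a vanishing factor: [s] as b tends to infinity, [x1] by (O1), [x3] by (O3), [v]
   by b = o(N). *)
pose err N := (D + 2 ^+ k) * C0 * s N + D * C0 * x1 N + D * C0 * (x3 N * v N)
    + 2 * k%:R * Cat * 2 ^+ k * v N.
have est N : (0 < N)%N -> `|r N - Cat * (1 + q N) ^+ k./2| <= err N.
  move=> N0; apply: (moment_estimate N0 (b_pos N) (ltn0Sn B0) (rel_equiv N) (rel_swap N) (eB N)).
  - move=> x; apply: (le_trans (walk_moment_le (X_meas N) (XM N) x)).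
    by rewrite lerD2l ler_wpM2l// ler_norm.
  - move=> x l; exact: (walk_moment_single (rel_equiv N) (X_meas N) (X_mean N) (XM N) (X_indep N)).
  - move=> x; exact: (walk_moment_tree (rel_equiv N) (X_meas N) (X_sym N) (X_var N) (XM N) (X_indep N)).
  - by move=> p; exact: (leq_bigmax p).
  - by [].
have q_cvg : q @ \oo --> (0 : R) by exact: cvg_inv_double.
have s_cvg : s @ \oo --> (0 : R).
  have -> : s = Num.sqrt \o q.
    by apply/funext => N; rewrite /s /q /= sqrtrV// mulr_ge0.
  by rewrite -[X in _ --> X]sqrtr0; apply: cvg_comp q_cvg _; exact: sqrt_continuous.
have x1_cvg : x1 @ \oo --> (0 : R) by exact: littleo_seq_cvg O1.
have x3_cvg : x3 @ \oo --> (0 : R) by exact: littleo_seq_cvg O3.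
have v_cvg : v @ \oo --> (0 : R) by exact: littleo_seq_cvg b_o.
have err_cvg : err @ \oo --> (0 : R).
  have cst_cvg (c : R) (f : nat -> R) : f @ \oo --> (0 : R) -> (fun N => c * f N) @ \oo --> (0 : R).
    by move=> f0; rewrite -[X in _ --> X](mulr0 c); apply: cvgM f0; exact: cvg_cst.
  have add_cvg (f g : nat -> R) : f @ \oo --> (0 : R) -> g @ \oo --> (0 : R) ->
      (fun N => f N + g N) @ \oo --> (0 : R).
    by move=> f0 g0; rewrite -[X in _ --> X](addr0 0); exact: cvgD.
  have x3v_cvg : (fun N => x3 N * v N) @ \oo --> (0 : R).
    by rewrite -[X in _ --> X](mulr0 0); exact: cvgM.
  exact: (add_cvg _ _ (add_cvg _ _ (add_cvg _ _ (cst_cvg _ _ s_cvg)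
    (cst_cvg _ _ x1_cvg)) (cst_cvg _ _ x3v_cvg)) (cst_cvg _ _ v_cvg)).
have main_cvg : (fun N => Cat * (1 + q N) ^+ k./2) @ \oo --> Cat.
  have u_cvg : (fun N => 1 + q N) @ \oo --> (1 : R).
    by rewrite -[X in _ --> X](addr0 1); apply: cvgD => //; exact: cvg_cst.
  have pow_cvg := cvg_comp _ _ u_cvg (@exprn_continuous R k./2 1).
  rewrite [X in _ --> X](_ : Cat = Cat * 1 ^+ k./2); last by rewrite expr1n mulr1.
  exact: (cvgM (cvg_cst Cat) pow_cvg).
(* The centre [Cat * (1 + q N) ^+ k./2] tends to [Cat] because [q] tends to 0. *)
apply: (@squeeze_cvgr _ _ _ _ (fun N => Cat * (1 + q N) ^+ k./2 - err N)
    (fun N => Cat * (1 + q N) ^+ k./2 + err N)).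
- near=> N; have N0 : (0 < N)%N by near: N; exact: nbhs_infty_gt.
  by have := est N N0; rewrite ler_distl.
- by rewrite -[X in _ --> X]subr0; exact: cvgB.
- by rewrite -[X in _ --> X]addr0; exact: cvgD.
Unshelve. all: end_near.
Qed.
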